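(* Let $\sigma:\Sigma\to\Sigma$ be a topologically transitive one-sided subshift of finite type over the alphabet $A$ and let $\psi:\Sigma\to\mathbb{R}$, $v:\Sigma\to(-\infty,0)$ and $u:\Sigma\to(0,+\infty)$ be Hölder continuous. Let $\mathcal{W}$ be a finite set of admissible words over $A$, and let $\mathcal{F}_{\mathcal{W}}=\bigcup_{k=1}^\infty\mathcal{F}_{\mathcal{W},k}$, where $$\mathcal{F}_{\mathcal{W},k}=\bigcap_{n=0}^\infty\{\xi\in\Sigma:\text{all the words in }\mathcal{W}\text{ are subwords of }\xi_{n+1}\cdots\xi_{n+k}\}.$$ Then for every $\alpha\in\mathbb{R}$ with $\alpha\notin\{\alpha^-_{\psi,v},\alpha^+_{\psi,v}\}$, $$\dim_u(\mathcal{UL}^\alpha_{\psi,v}\cap\mathcal{F}_{\mathcal{W}})=\dim_u(\mathcal{L}^\alpha_{\psi,v}).$$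
   Context: Subshift of finite type (SFT): $A$ is a finite set with at least two symbols, and $\mathbb{M}:A\times A\to\{0,1\}$ is a matrix such that for each $a\in A$ there is $b\in A$ with $\mathbb{M}(a,b)=1$. A word or infinite sequence over $A$ is admissible if each of its subwords $ab$ of length two (consecutive letters) satisfies $\mathbb{M}(a,b)=1$ (the empty word and words of length one are admissible). Subwords are contiguous blocks. $\Sigma\subseteq A^{\mathbb{N}}$ ($\mathbb{N}=\{1,2,\dots\}$) is the set of admissible sequences and $\sigma(\xi_1\xi_2\cdots)=\xi_2\xi_3\cdots$. The SFT is topologically transitive iff for all $a,b\in A$ there is an admissible word $\rho$ (possibly empty) with $a\rho b$ admissible. For an admissible word $\omega$ of length $|\omega|$, $[\omega]=\{\xi\in\Sigma:\xi_1\cdots\xi_{|\omega|}=\omega\}$; $[\text{empty word}]=\Sigma$. Birkhoff sums: $S_nf=\sum_{k=0}^{n-1}f\circ\sigma^k$, $S_0f=0$; for an admissible word $\omega$, $S_\omega f=\sup_{\xi\in[\omega]}S_{|\omega|}f(\xi)$. Metrics: for distinct $\xi,\xi'\in\Sigma$ let $\xi\wedge\xi'$ be their longest common initial block; $d_1(\xi,\xi')=\exp(-|\xi\wedge\xi'|)$. Hölder continuity of functions on $\Sigma$ is with respect to $d_1$ (with some positive exponent). For Hölder continuous $u:\Sigma\to(0,+\infty)$, $d_u(\xi,\xi')=\exp(S_{\xi\wedge\xi'}(-u))$ for $\xi\neq\xi'$, which is a metric on $\Sigma$. The $u$-dimension $\dim_u(E)$ of $E\subseteq\Sigma$ is the Hausdorff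 dimension of $E$ in $(\Sigma,d_u)$ (with $\dim_u\varnothing=0$). Level sets: $\mathcal{L}^\alpha_{\psi,v}=\{\xi\in\Sigma:\lim_{n\to+\infty}S_n\psi(\xi)/S_nv(\xi)=\alpha\}$, $\mathcal{UL}^\alpha_{\psi,v}=\{\xi\in\Sigma:\sup_{n\in\mathbb{N}}|S_n\psi(\xi)-\alpha S_nv(\xi)|<+\infty\}$. Boundary values: $$\alpha^-_{\psi,v}=\inf_{\xi\in\Sigma}\liminf_{n\to+\infty}\frac{S_n\psi(\xi)}{S_nv(\xi)},\qquad \alpha^+_{\psi,v}=\sup_{\xi\in\Sigma}\limsup_{n\to+\infty}\frac{S_n\psi(\xi)}{S_nv(\xi)}.$$ *)

(* Defs.v *)
From HB Require Import structures.
From mathcomp Require Import all_boot all_order all_algebra.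
From mathcomp Require Import all_classical all_reals all_analysis.
Import Order.TTheory GRing.Theory Num.Theory.
Import numFieldNormedType.Exports.

Set Implicit Arguments.
Unset Strict Implicit.
Unset Printing Implicit Defensive.

Local Open Scope classical_set_scope.
Local Open Scope ring_scope.

Definition holder (R : realType) (T : Type) (d : T -> T -> R) (f : T -> R)
    : Prop :=
  exists C theta : R, 0 < theta /\
    forall x y : T, `|f x - f y| <= C * (d x y) `^ theta.

Local Open Scope ereal_scope.

(** The maximum with [0] only matters for [U = set0], whose [ereal_sup] is
    [-oo]. *)
Definition diameter (R : realType) (T : Type) (d : T -> T -> R) (U : set T)
    : \bar R :=
  maxe 0 (ereal_sup [set (d x y)%:E | x in U & y in U]).

(** The empty set contributes [0] also when [s = 0], whereas a nonempty set of
    diameter [0] then contributes [0 `^ 0 = 1]. *)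
Definition hausdorff_gauge (R : realType) (T : Type) (d : T -> T -> R) (s : R)
    (U : set T) : \bar R :=
  if `[< U = set0 >] then 0 else diameter d U `^ s.

Definition hausdorff_content (R : realType) (T : Type) (d : T -> T -> R)
    (s delta : R) (E : set T) : \bar R :=
  ereal_inf [set \sum_(0 <= k <oo) hausdorff_gauge d s (U k) | U in
    [set U : (set T)^nat | E `<=` \bigcup_k U k /\
                           forall k, diameter d (U k) <= delta%:E]].

Definition hausdorff_measure (R : realType) (T : Type) (d : T -> T -> R)
    (s : R) (E : set T) : \bar R :=
  ereal_sup [set hausdorff_content d s delta E | delta in
    [set delta : R | (0 < delta)%R]].

(** [hausdorff_measure d 0 set0 = 0], so that the dimension of [set0] is [0]. *)
Definition hausdorff_dim (R : realType) (T : Type) (d : T -> T -> R)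
    (E : set T) : \bar R :=
  ereal_inf [set s%:E | s in
    [set s : R | (0 <= s)%R /\ hausdorff_measure d s E = 0]].

Local Close Scope ereal_scope.

(** Sequences are indexed from [0], so the letter [xi_i] of the usual
    one-based notation is [x i.-1]. A word is a [seq A], and it is admissible
    when it is [sorted M]. *)
Record sft (A : finType) (M : rel A) := Sft {
  sft_seq :> nat -> A;
  sft_admissible : forall n, M (sft_seq n) (sft_seq n.+1)
}.

Definition shift (A : finType) (M : rel A) (x : sft M) : sft M :=
  Sft (fun n => sft_admissible x n.+1).

Definition sft_transitive (A : finType) (M : rel A) : Prop :=
  forall a b : A, exists rho : seq A, sorted M (a :: rcons rho b).

(** The subword of length [k] that starts after the first [n] letters. *)
Definition block (A : finType) (M : rel A) (x : sft M) (n k : nat) : seq A :=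
  mkseq (fun i => x (n + i)%N) k.

Definition cylinder (A : finType) (M : rel A) (w : seq A) : set (sft M) :=
  [set x | block x 0 (size w) = w].
Arguments cylinder {A} M w.

Definition birkhoff (R : realType) (A : finType) (M : rel A) (f : sft M -> R)
    (n : nat) (x : sft M) : R :=
  \sum_(k < n) f (iter k (@shift A M) x).

Definition word_birkhoff (R : realType) (A : finType) (M : rel A)
    (f : sft M -> R) (w : seq A) : R :=
  sup [set birkhoff f (size w) x | x in cylinder M w].

(** The length of the common initial block that cannot be extended; it is only
    used for distinct [x] and [y], where such a length exists and is unique. *)
Definition wedge_length (A : finType) (M : rel A) (x y : sft M) : nat :=
  xget 0%N [set n | block x 0 n = block y 0 n /\ x n <> y n].

Definition wedge (A : finType) (M : rel A) (x y : sft M) : seq A :=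
  block x 0 (wedge_length x y).

Definition dist1 (R : realType) (A : finType) (M : rel A) (x y : sft M) : R :=
  if `[< x = y >] then 0 else expR (- (size (wedge x y))%:R).

Definition distu (R : realType) (A : finType) (M : rel A) (u : sft M -> R)
    (x y : sft M) : R :=
  if `[< x = y >] then 0
  else expR (word_birkhoff (fun z => - u z) (wedge x y)).

Definition udim (R : realType) (A : finType) (M : rel A) (u : sft M -> R)
    (E : set (sft M)) : \bar R :=
  hausdorff_dim (distu u) E.

Definition level_set (R : realType) (A : finType) (M : rel A)
    (psi v : sft M -> R) (alpha : R) : set (sft M) :=
  [set x | (fun n => birkhoff psi n x / birkhoff v n x) @ \oo --> alpha].

Definition uniform_level_set (R : realType) (A : finType) (M : rel A)
    (psi v : sft M -> R) (alpha : R) : set (sft M) :=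
  [set x | (ereal_sup [set `|birkhoff psi n x - alpha * birkhoff v n x|%:E |
                        n in [set n : nat | (0 < n)%N]] < +oo)%E].

Definition alpha_minus (R : realType) (A : finType) (M : rel A)
    (psi v : sft M -> R) : \bar R :=
  ereal_inf [set limn_einf (fun n => (birkhoff psi n x / birkhoff v n x)%:E) |
              x in [set: sft M]].

Definition alpha_plus (R : realType) (A : finType) (M : rel A)
    (psi v : sft M -> R) : \bar R :=
  ereal_sup [set limn_esup (fun n => (birkhoff psi n x / birkhoff v n x)%:E) |
              x in [set: sft M]].

Definition frequent_in (A : finType) (M : rel A) (W : set (seq A)) (k : nat)
    : set (sft M) :=
  \bigcap_n [set x : sft M | forall w, W w -> infix w (block x n k)].
Arguments frequent_in {A} M W k.

Definition frequent (A : finType) (M : rel A) (W : set (seq A))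
    : set (sft M) :=
  \bigcup_(k in [set k : nat | (1 <= k)%N]) frequent_in M W k.
Arguments frequent {A} M W.

(* Main.v *)
(* With [phi = psi - alpha v], the level set is [S_n phi = o(n)] and the uniform
   one is [S_n phi = O(1)]. If the level set has positive [s]-dimensional
   Hausdorff measure then, by Borel-Cantelli, for infinitely many [n] the words
   of length [n] on which [|S_n phi| <= eps n] have a total weight of order
   [e^(c n)] for any exponent [r < s], with [c] independent of [eps]. Since
   [alpha] lies strictly between the boundary values, there are words on which
   the Birkhoff sum of [phi] is arbitrarily large, and arbitrarily negative.
   Follow each such word of length [n] by a tail of length [O(eps n)] that
   contains all of [W], closes up, and has a Birkhoff sum of a prescribed sign
   outweighing that of the word. Concatenating infinitely many of these blocks,
   each time with the sign opposite to that of the sum so far, keeps [S_n phi]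
   bounded, and the weight lost in the tails is absorbed by [e^(c n)]: the
   resulting Cantor set has positive [r]-dimensional measure. *)

Require Import Defs.
From HB Require Import structures.
From mathcomp Require Import all_boot all_order all_algebra.
From mathcomp Require Import all_classical all_reals all_analysis.
From mathcomp Require Import zify lra.
Import Order.TTheory GRing.Theory Num.Theory.
Import numFieldNormedType.Exports.

Set Implicit Arguments.
Unset Strict Implicit.
Unset Printing Implicit Defensive.

Local Open Scope classical_set_scope.
Local Open Scope ring_scope.

(** * Infinite paths in trees *)

(** Dependent choice along finite words; it also serves as König's lemma for nested cylinders. *)
Lemma greedy_path (I : Type) (P : seq I -> Prop) :
  P [::] -> (forall p, P p -> exists i, P (rcons p i)) ->
  exists x : nat -> I, forall n, P (mkseq x n).
Proof.
move=> P0 PS; have [i0 _] := PS _ P0.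
have /choice[f fP] p : exists i, P p -> P (rcons p i).
  by have [/PS[i Pi]|nPp] := pselect (P p); [exists i | exists i0].
pose s n := iter n (fun p => rcons p (f p)) [::].
have sE n : mkseq (f \o s) n = s n by elim: n => // n IH; rewrite mkseqS IH.
by exists (f \o s) => n; rewrite sE; elim: n => //= n; apply: fP.
Qed.

(* Replaces the mass distribution principle: following a child that costs less
   than its weight at each step yields a path that avoids all the nodes [Q k]. *)
Lemma tree_cover (R : realType) (I : finType) (w : seq I -> R)
    (Q : nat -> seq I) :
  (forall p, 0 <= w p) -> (forall p, w p <= \sum_i w (rcons p i)) ->
  (\sum_(0 <= k <oo) (w (Q k))%:E < (w [::])%:E)%E ->
  exists x : nat -> I, forall k, mkseq x (size (Q k)) <> Q k.
Proof.
move=> w0 wS Qw.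
(* The total weight of the nodes [Q k] at or below [p]; the path is kept where this is less than
   [w p]. *)
pose cost p := (\sum_(0 <= k <oo) (if prefix p (Q k) then w (Q k) else 0)%:E)%E.
have g0 (p : seq I) k :
    (0 <= (if prefix p (Q k) then w (Q k) else 0)%:E)%E.
  by rewrite lee_fin; case: ifP.
have [|p cp|x xP] := @greedy_path I (fun p => (cost p < (w p)%:E)%E).
- by rewrite /cost; under eq_eseriesr do rewrite prefix0s.
- apply: contrapT => /forallNP noi.
  have : ((\sum_i w (rcons p i))%:E <= cost p)%E.
    rewrite -sumEFin.
    apply: (@le_trans _ _ (\sum_i cost (rcons p i))%E).
      by apply: lee_sum => i _; rewrite leNgt; apply/negP/noi.
    rewrite /cost -nneseries_sum//; apply: lee_nneseries => [k _ _|k _].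
      by apply: sume_ge0 => i _.
    rewrite sumEFin lee_fin.
    (* A node strictly below [p] is at or below exactly one child, and [p] itself is below none, so
       the costs of the children add up to at most [cost p]. *)
    have [pQ|pQ] := boolP (prefix p (Q k)); last first.
      rewrite big1// => i _; case: ifP => // /prefixP[s Qs].
      by move: pQ; rewrite Qs cat_rcons prefix_prefix.
    have /prefixP[[|i s] Qs] := pQ.
      rewrite big1// => i _; case: ifP => // /prefixP[t Qt].
      have /(congr1 size) := etrans (esym Qs) Qt.
      by rewrite !size_cat size_rcons /=; lia.
    rewrite (bigD1 i)//= big1 ?addr0 => [|j ji].
      by rewrite Qs -cat_rcons prefix_prefix.
    case: ifP => // /prefixP[t Qt].
    move: ji; have := etrans (esym Qs) Qt; rewrite cat_rcons.
    by move/eqP; rewrite eqseq_cat// eqxx/= => /eqP[->]; rewrite eqxx.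
  by rewrite leNgt => /negP; apply; apply: (lt_le_trans cp); rewrite lee_fin.
- exists x => k xQ.
  have := xP (size (Q k)); rewrite xQ ltNge => /negP; apply.
  rewrite /cost (@nneseriesD1 _ _ k xpredT)// prefix_refl.
  by rewrite leeDl// nneseries_ge0.
Qed.

(** * Sequences and Birkhoff sums *)

Section Sft.
Context (A : finType) (M : rel A).
Implicit Types (x y z : sft M).
Local Notation sigma := (@Defs.shift A M).

Lemma sft_ext x y : (forall i, x i = y i) -> x = y.
Proof.
case: x y => [x hx] [y hy] /= xy.
have {}xy : x = y by apply: funext.
by subst y; congr Sft; apply: Prop_irrelevance.
Qed.

Lemma iter_shiftE k x i : iter k sigma x i = x (k + i)%N.
Proof. by elim: k i => //= k IH i; rewrite IH addnS. Qed.

Lemma size_block x m n : size (block x m n) = n.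
Proof. exact: size_mkseq. Qed.

Lemma block_inj x y n :
  (block x 0 n = block y 0 n) <-> (forall i, (i < n)%N -> x i = y i).
Proof.
split=> [e i ilt|e].
  by have /(congr1 (fun s => nth (x 0) s i)) := e; rewrite !nth_mkseq.
apply: (@eq_from_nth _ (x 0)); rewrite ?size_block// => i ilt.
by rewrite !nth_mkseq// e.
Qed.

Lemma block_shift k x m n : block (iter k sigma x) m n = block x (k + m) n.
Proof. by apply: eq_mkseq => i; rewrite iter_shiftE addnA. Qed.

Lemma block_cat x k m n :
  block x k (m + n) = block x k m ++ block x (k + m) n.
Proof.
rewrite /block /mkseq iotaD map_cat add0n; congr (_ ++ _).
rewrite -[X in iota X n]addn0 iotaDl -map_comp.
by apply: eq_map => i /=; rewrite addnA.
Qed.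

Lemma block_sorted x m n : sorted M (block x m n).
Proof.
case: n => // n; rewrite /block.
apply/(sortedP (x 0)) => i; rewrite size_mkseq => ilt.
rewrite !nth_mkseq ?addnS; [exact: sft_admissible|exact: ilt|exact: ltnW].
Qed.

Lemma cylinder_cat x (p q : seq A) :
  cylinder M (p ++ q) x <->
  cylinder M p x /\ cylinder M q (iter (size p) sigma x).
Proof.
rewrite /cylinder /= size_cat block_cat add0n block_shift addn0; split.
  by move/eqP; rewrite eqseq_cat ?size_block// => /andP[/eqP-> /eqP->].
by move=> [-> ->].
Qed.

Lemma cylinder_block x n : cylinder M (block x 0 n) x.
Proof. by rewrite /cylinder /= size_block. Qed.

Lemma cylinder_nonempty (w : seq A) : (forall a, exists b, M a b) ->
  (0 < #|A|)%N -> sorted M w -> exists x, cylinder M w x.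
Proof.
move=> hM A0 wM; have /card_gt0P[a0 _] := A0.
(* While [p] is shorter than [w], this makes it a prefix of [w]; afterwards [p] extends [w] by
   letters taken from [hM]. *)
pose P p := sorted M p /\ exists s, p = take (size p) w ++ s.
have [||x xP] := @greedy_path A P.
- by split=> //; exists [::]; rewrite take0.
- move=> p [pM [s ps]].
  have [ltp|lep] := ltnP (size p) (size w).
    have s0 : s = [::].
      apply/size0nil; move/(congr1 size): ps.
      by rewrite size_cat size_takel ?(ltnW ltp)//; lia.
    have {}ps : p = take (size p) w by rewrite {1}ps s0 cats0.
    exists (nth a0 w (size p)).
    have E : rcons p (nth a0 w (size p)) = take (size p).+1 w.
      by rewrite (take_nth a0)// -ps.
    split; first by rewrite E take_sorted.
    by exists [::]; rewrite size_rcons cats0.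
  have [b Mb] := hM (last a0 p); exists b; split; last first.
    exists (rcons s b); rewrite size_rcons take_oversize; last by lia.
    by rewrite -rcons_cat {1}ps take_oversize.
  by case: (p) pM Mb => //= c p' pM Mb; rewrite rcons_path pM.
have xM n : M (x n) (x n.+1).
  have [/(sortedP a0)/(_ n)] := xP n.+2.
  by rewrite size_mkseq ltnSn !nth_mkseq// => /(_ isT).
exists (Sft xM); rewrite /cylinder /= /block /=.
have [_ [s /esym]] := xP (size w).
rewrite size_mkseq take_size => e.
have : s = [::].
  by apply/size0nil; move/(congr1 size): e; rewrite size_cat size_mkseq; lia.
by move=> s0; rewrite -[RHS]cats0 -s0 e; apply: eq_mkseq => i; rewrite add0n.
Qed.

(** The default of [xget] is not reached: the least index at which the two sequences differ
    qualifies. *)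
Lemma wedge_lengthP x y : x <> y ->
  block x 0 (wedge_length x y) = block y 0 (wedge_length x y) /\
  x (wedge_length x y) <> y (wedge_length x y).
Proof.
move=> xy; have /existsNP[i xyi] : ~ forall i, x i = y i by move=> /sft_ext.
have ex : exists n, x n != y n by exists i; apply/eqP.
rewrite /wedge_length; case: xgetP => [n ->//|none]; exfalso.
case: (ex_minnP ex) => n xyn min; apply: (none n); split; last exact/eqP.
apply/block_inj => j jn; apply: contrapT => /eqP /min.
by rewrite leqNgt jn.
Qed.

Lemma wedge_length_ge x y n : x <> y -> block x 0 n = block y 0 n ->
  (n <= wedge_length x y)%N.
Proof.
move=> /wedge_lengthP[_ xy] /block_inj e; rewrite leqNgt; apply/negP => lt.
exact/xy/e.
Qed.

Section Birkhoff.
Context (R : realType).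
Implicit Types f g : sft M -> R.

Lemma birkhoff0 f x : birkhoff f 0 x = 0.
Proof. by rewrite /birkhoff big_ord0. Qed.

Lemma birkhoffD f m n x :
  birkhoff f (m + n) x = birkhoff f m x + birkhoff f n (iter m sigma x).
Proof.
rewrite /birkhoff big_split_ord /=; congr (_ + _).
by apply: eq_bigr => k _; rewrite addnC iterD.
Qed.

Lemma birkhoffN f n x : birkhoff (fun z => - f z) n x = - birkhoff f n x.
Proof. by rewrite /birkhoff sumrN. Qed.

Lemma birkhoff_lin f g (c : R) n x :
  birkhoff (fun z => f z - c * g z) n x = birkhoff f n x - c * birkhoff g n x.
Proof. by rewrite /birkhoff sumrB mulr_sumr. Qed.

Lemma birkhoff_ge f (c : R) n x : (forall z, c <= f z) -> n%:R * c <= birkhoff f n x.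
Proof.
move=> cf; rewrite mulr_natl -[X in _ *+ X]card_ord -sumr_const.
by apply: ler_sum => k _.
Qed.

Lemma birkhoff_norm f (B : R) n x :
  (forall z, `|f z| <= B) -> `|birkhoff f n x| <= n%:R * B.
Proof.
move=> fB; rewrite mulr_natl -[X in _ *+ X]card_ord -sumr_const.
by apply: le_trans (ler_norm_sum _ _ _) _; apply: ler_sum => k _.
Qed.

(** Bounded distortion, with one constant for all lengths. Together with boundedness and, for [u]
    and [- v], a positive lower bound, it is all that the argument retains of Hölder continuity. *)
Definition distortion f (D : R) := forall n x y,
  block x 0 n = block y 0 n -> `|birkhoff f n x - birkhoff f n y| <= D.

Lemma dist1_le x y n : block x 0 n = block y 0 n ->
  dist1 R x y <= expR (- n%:R).
Proof.
move=> e; rewrite /dist1; case: asboolP => [_|xy]; first exact: expR_ge0.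
by rewrite size_block ler_expR lerN2 ler_nat wedge_length_ge.
Qed.

Lemma dist1_ge0 x y : 0 <= dist1 R x y.
Proof. by rewrite /dist1; case: asboolP => // _; exact: expR_ge0. Qed.

Lemma holder_block f : holder (@dist1 R A M) f ->
  exists C q : R, [/\ 0 <= C, 0 < q < 1 & forall n x y,
    block x 0 n = block y 0 n -> `|f x - f y| <= C * q ^+ n].
Proof.
move=> [C [th [th0 hf]]]; exists `|C|, (expR (- th)); split => //.
  by rewrite expR_gt0 expR_lt1 oppr_lt0 th0.
move=> n x y /dist1_le exy; apply: (le_trans (hf x y)).
have -> : expR (- th) ^+ n = expR (- n%:R) `^ th.
  by rewrite -expRM_natl -expRM mulrN mulNr.
apply: (@le_trans _ _ (`|C| * dist1 R x y `^ th)).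
  by rewrite ler_wpM2r ?powR_ge0// ler_norm.
apply: ler_wpM2l => //; apply: ge0_ler_powR (ltW th0) _ _ _ _ _ => //.
- exact: dist1_ge0.
- exact: expR_ge0.
Qed.

Lemma holder_bounded f : (forall a, exists b, M a b) -> (0 < #|A|)%N ->
  holder (@dist1 R A M) f ->
  exists2 B : R, 0 < B & forall x, `|f x| <= B.
Proof.
move=> hM A0 /holder_block[C [q [C0 q01 hf]]].
have [x0 _] := @cylinder_nonempty [::] hM A0 isT.
exists (`|f x0| + C + 1) => [|x]; first by have := normr_ge0 (f x0); lra.
have := hf 0%N x x0 erefl; rewrite expr0.
have := ler_normD (f x - f x0) (f x0); rewrite subrK; lra.
Qed.

(** The [k]-th terms belong to points that agree on [n - k] letters, so the differences are
    dominated by a geometric series. *)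
Lemma holder_distortion f : holder (@dist1 R A M) f ->
  exists2 D : R, 0 <= D & distortion f D.
Proof.
move=> /holder_block[C [q [C0 /andP[q0 q1] hf]]].
exists (C / (1 - q)); first by rewrite divr_ge0// subr_ge0 ltW.
move=> n x y e; rewrite /birkhoff -sumrB.
apply: (le_trans (ler_norm_sum _ _ _)).
have /ler_sum/le_trans -> // : forall k : 'I_n, true ->
    `|f (iter k sigma x) - f (iter k sigma y)| <= C * q ^+ (n - k).
  move=> k _; apply: hf; apply/block_inj => i ilt; rewrite !iter_shiftE.
  by move/block_inj : e; apply; move: (ltn_ord k) ilt; lia.
have -> : \sum_(k < n) C * q ^+ (n - k) = q * series (geometric C q) n.
  rewrite /series/= big_mkord mulr_sumr (reindex_inj rev_ord_inj)/=.
  apply: eq_bigr => k _; rewrite subKn// exprS mulrCA; congr (_ * _).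
apply: (@le_trans _ _ (1 * series (geometric C q) n)).
  apply: ler_wpM2r (ltW q1); apply: sumr_ge0 => k _ /=.
  by rewrite mulr_ge0// exprn_ge0// ltW.
by rewrite mul1r geometric_le_lim// ger0_norm// ltW.
Qed.

(** Compactness: if [f] came arbitrarily close to [0], it would do so on each of a nested sequence
    of cylinders, and by continuity it would vanish at their common point. *)
Lemma holder_pos f : (0 < #|A|)%N -> (forall a, exists b, M a b) ->
  holder (@dist1 R A M) f -> (forall x, 0 < f x) ->
  exists2 c : R, 0 < c & forall x, c <= f x.
Proof.
move=> A0 hM /holder_block[C [q [C0 q01 hf]]] f0.
apply: contrapT => nc.
have {}nc (c : R) : 0 < c -> exists x, f x < c.
  move=> c0; apply: contrapT => /forallNP H; apply: nc; exists c => // x.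
  by rewrite leNgt; apply/negP/H.
pose P (p : seq A) := forall c : R, 0 < c -> exists2 x, cylinder M p x & f x < c.
have [||x xP] := @greedy_path A P.
- by move=> c /nc[x fx]; exists x.
- move=> p Pp; apply: contrapT => /forallNP H.
  have /choice[c cP] a : exists c : R, 0 < c /\
      forall x, cylinder M (rcons p a) x -> c <= f x.
    have /existsNP[c /not_implyP[c0 Hc]] := H a.
    exists c; split => // x px; rewrite leNgt; apply/negP => fx.
    by apply: Hc; exists x.
  (* If [f] had a positive lower bound on each one-letter extension, the minimum over the finite
     alphabet would be one on the cylinder of [p]. *)
  pose c0 := \big[Order.min/1]_a c a.
  have c00 : 0 < c0.
    rewrite /c0; elim/big_ind : _ => // [y z y0 z0|a _].
      by rewrite lt_min y0.
    by have [] := cP a.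
  have [x px fx] := Pp _ c00.
  have := cP (x (size p)); move=> [_ /(_ x)].
  have /[swap]/[apply] : cylinder M (rcons p (x (size p))) x.
    move: px; rewrite /cylinder/= size_rcons -addn1 block_cat add0n => {1}->.
    by rewrite /block /mkseq /= addn0 cats1.
  rewrite leNgt => /negP; apply; apply: (lt_le_trans fx).
  exact: bigmin_le.
have xM n : M (x n) (x n.+1).
  have [|y] := xP n.+2 1; first exact: ltr01.
  rewrite /cylinder /mkset size_mkseq.
  move=> /(congr1 (fun s => (nth (x 0%N) s n, nth (x 0%N) s n.+1))).
  rewrite !nth_mkseq// => -[<- <-] _; rewrite add0n addnS; exact: sft_admissible.
have := f0 (Sft xM); set z := Sft xM => z0.
have /andP[q0 q1] := q01.
have : (fun n => C * q ^+ n) @ \oo --> 0.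
  by apply: cvg_geometric; rewrite ger0_norm// ltW.
move=> /cvgr0_norm_lt/(_ (f z / 2)); rewrite divr_gt0// => /(_ isT)[n _ /(_ n (leqnn n))].
rewrite /= ger0_norm; last by rewrite mulr_ge0// exprn_ge0// ltW.
move=> Cq.
have [|y yz fy] := xP n (f z / 2); first by rewrite divr_gt0.
have := hf n z y; move: yz; rewrite /cylinder /mkset size_mkseq => ->.
move=> /(_ erefl); rewrite ler_norml => /andP[_]; lra.
Qed.

End Birkhoff.
End Sft.

(** * Hausdorff measure *)

Section Hausdorff.
Context (R : realType) (T : Type) (d : T -> T -> R).
Local Open Scope ereal_scope.

Lemma hausdorff_gauge_ge0 s U : 0 <= hausdorff_gauge d s U.
Proof. by rewrite /hausdorff_gauge; case: asboolP => // _; exact: poweR_ge0. Qed.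

Lemma hausdorff_content_ge0 s delta E : 0 <= hausdorff_content d s delta E.
Proof.
apply: le_ereal_inf_tmp => _ [U _ <-]; apply: nneseries_ge0 => k _ _.
exact: hausdorff_gauge_ge0.
Qed.

Lemma le_hausdorff_measure s E F : E `<=` F ->
  hausdorff_measure d s E <= hausdorff_measure d s F.
Proof.
move=> EF; apply: ge_ereal_sup => _ [delta delta0 <-].
apply: le_ereal_sup_tmp; exists (hausdorff_content d s delta F); first by exists delta.
apply: ereal_inf_le_tmp => _ [U [FU Ud] <-]; exists U => //; split => //.
exact: subset_trans FU.
Qed.

Lemma hausdorff_measure_ge0 s E : 0 <= hausdorff_measure d s E.
Proof.
apply: le_ereal_sup_tmp; exists (hausdorff_content d s 1 E).
  by exists 1%R => //=; rewrite ltr01.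
exact: hausdorff_content_ge0.
Qed.

Lemma hausdorff_measure_eq0 s E :
  (forall delta eta : R, (0 < delta)%R -> (0 < eta)%R ->
   exists U : (set T)^nat, [/\ E `<=` \bigcup_k U k,
     forall k, diameter d (U k) <= delta%:E &
     \sum_(0 <= k <oo) hausdorff_gauge d s (U k) <= eta%:E]) ->
  hausdorff_measure d s E = 0.
Proof.
move=> H; apply/eqP; rewrite eq_le hausdorff_measure_ge0 andbT.
apply: ge_ereal_sup => _ [delta delta0 <-]; apply/lee_addgt0Pr => eta eta0.
have [U [EU Ud Us]] := H delta eta delta0 eta0; rewrite add0e.
by apply: le_trans Us; apply: ereal_inf_lbound; exists U.
Qed.

Lemma hausdorff_measure_neq0 s E (c : R) : (0 < c)%R ->
  (forall U : (set T)^nat, E `<=` \bigcup_k U k ->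
   c%:E <= \sum_(0 <= k <oo) hausdorff_gauge d s (U k)) ->
  hausdorff_measure d s E <> 0.
Proof.
move=> c0 H E0.
have : c%:E <= hausdorff_measure d s E.
  apply: le_ereal_sup_tmp; exists (hausdorff_content d s 1 E).
    by exists 1%R => //=; rewrite ltr01.
  by apply: le_ereal_inf_tmp => _ [U [EU _] <-]; apply: H.
by rewrite E0 lee_fin leNgt c0.
Qed.

Lemma hausdorff_dim_subset E F : E `<=` F -> hausdorff_dim d E <= hausdorff_dim d F.
Proof.
move=> EF; apply: ereal_inf_le_tmp => _ [s [s0 Fs] <-]; exists s => //; split => //.
apply/eqP; rewrite eq_le hausdorff_measure_ge0 andbT -Fs.
exact: le_hausdorff_measure.
Qed.

(** Comparing at exponents with an arbitrarily small gap is enough, and the gap leaves room to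
    absorb the weight lost in the tails. *)
Lemma le_hausdorff_dim E F :
  (forall r s, (0 <= r < s)%R -> hausdorff_measure d r F = 0 ->
    hausdorff_measure d s E = 0) ->
  hausdorff_dim d E <= hausdorff_dim d F.
Proof.
move=> H; apply: le_ereal_inf_tmp => _ [r [r0 Fr] <-].
apply/lee_addgt0Pr => e e0; apply: ereal_inf_lbound.
exists (r + e)%R => //; split; first by rewrite addr_ge0// ltW.
by apply: H Fr; rewrite r0 ltrDl.
Qed.

Lemma diameter_ge0 U : 0 <= diameter d U.
Proof. by rewrite /diameter le_max lexx. Qed.

Lemma diameter_le U (c : R) : (0 <= c)%R ->
  (forall x y, U x -> U y -> (d x y <= c)%R) -> diameter d U <= c%:E.
Proof.
move=> c0 H; rewrite /diameter ge_max lee_fin c0/=.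
by apply: ge_ereal_sup => _ [x Ux [y Uy <-]]; rewrite lee_fin; apply: H.
Qed.

Lemma diameter_set0 : diameter d set0 = 0.
Proof. by apply/eqP; rewrite eq_le diameter_ge0 diameter_le. Qed.

Lemma hausdorff_gauge_set0 s : hausdorff_gauge d s set0 = 0.
Proof. by rewrite /hausdorff_gauge; case: asboolP. Qed.

Lemma hausdorff_gauge_le s U (c : R) : (0 <= s)%R ->
  diameter d U <= (expR c)%:E -> hausdorff_gauge d s U <= (expR (s * c))%:E.
Proof.
move=> s0 Uc; rewrite /hausdorff_gauge; case: asboolP => _.
  by rewrite lee_fin expR_ge0.
apply: (@le_trans _ _ ((expR c)%:E `^ s)).
  by apply: gt0_ler_poweR => //; rewrite in_itv/= leey ?diameter_ge0 ?lee_fin ?expR_ge0.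
by rewrite poweR_EFin mulrC expRM.
Qed.

Lemma hausdorff_gauge_ge s U x y (c : R) : (0 <= s)%R -> U x -> U y ->
  (expR c <= d x y)%R -> (expR (s * c))%:E <= hausdorff_gauge d s U.
Proof.
move=> s0 Ux Uy cxy; rewrite /hausdorff_gauge; case: asboolP => [U0|_].
  by rewrite U0 in Ux.
rewrite mulrC expRM -poweR_EFin.
have cd : (expR c)%:E <= diameter d U.
  rewrite /diameter le_max; apply/orP; right; apply: le_ereal_sup_tmp.
  by exists (d x y)%:E; [exists x => //; exists y|rewrite lee_fin].
by apply: gt0_ler_poweR => //; rewrite in_itv/= leey ?diameter_ge0 ?lee_fin ?expR_ge0.
Qed.

End Hausdorff.

(** * Weights of words and upper bounds for the measure in the metric [distu] *)

Section WordBirkhoff.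
Context (R : realType) (A : finType) (M : rel A) (f : sft M -> R) (D : R).
Hypothesis fD : distortion f D.

(** The point [x] excludes the empty cylinder, on which [sup] takes the default value [0]. *)
Lemma word_birkhoff_le (w : seq A) x (c : R) : cylinder M w x ->
  (forall y, cylinder M w y -> birkhoff f (size w) y <= c) ->
  word_birkhoff f w <= c.
Proof.
move=> wx H; apply: ge_sup; first by exists (birkhoff f (size w) x); exists x.
by move=> _ [y wy <-]; apply: H.
Qed.

Lemma birkhoff_near (w : seq A) x y : cylinder M w x -> cylinder M w y ->
  birkhoff f (size w) y <= birkhoff f (size w) x + D.
Proof.
move=> wx wy; have := fD (etrans wx (esym wy)).
by rewrite ler_norml => /andP[]; lra.
Qed.

Lemma word_birkhoff_ge (w : seq A) x : cylinder M w x ->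
  birkhoff f (size w) x <= word_birkhoff f w.
Proof.
move=> wx; apply: ub_le_sup; last by exists x.
by exists (birkhoff f (size w) x + D) => _ [y wy <-]; exact: birkhoff_near.
Qed.

Lemma word_birkhoff_near (w : seq A) x : cylinder M w x ->
  word_birkhoff f w <= birkhoff f (size w) x + D.
Proof.
by move=> wx; apply: (word_birkhoff_le wx) => y wy; exact: birkhoff_near.
Qed.

End WordBirkhoff.

Section DistU.
Context (R : realType) (A : finType) (M : rel A) (u : sft M -> R) (D c : R).
Hypothesis uD : distortion (fun z => - u z) D.
Hypothesis c0 : 0 < c.
Hypothesis uc : forall x, c <= u x.
Let wb := word_birkhoff (fun z => - u z).

Lemma word_birkhoff_opp_le (w : seq A) x : cylinder M w x ->
  wb w <= - ((size w)%:R * c).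
Proof.
move=> wx; apply: (word_birkhoff_le wx) => y wy.
by rewrite birkhoffN lerN2; apply: birkhoff_ge.
Qed.

(** Distinct points of the cylinder have a common initial block extending [w], and since [- u] is
    negative the extension can only lower the Birkhoff sum. *)
Lemma diameter_cylinder (w : seq A) :
  (diameter (distu u) (cylinder M w) <= (expR (wb w))%:E)%E.
Proof.
apply: diameter_le => [|x y wx wy]; first exact: expR_ge0.
rewrite /distu; case: asboolP => [_|xy]; first exact: expR_ge0.
have wxy : block x 0 (size w) = block y 0 (size w) by rewrite (_ : block x _ _ = w).
have lew := wedge_length_ge xy wxy.
rewrite ler_expR; apply: (word_birkhoff_le (cylinder_block x _)) => z.
rewrite size_block /cylinder /mkset size_block -(subnKC lew) !block_cat.
move=> /eqP; rewrite eqseq_cat ?size_block// => /andP[/eqP zw _].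
have wz : cylinder M w z by rewrite /cylinder /mkset zw.
apply: le_trans (word_birkhoff_ge uD wz); rewrite birkhoffD gerDl birkhoffN oppr_le0.
apply: le_trans (birkhoff_ge _ _ uc).
by rewrite mulr_ge0// ltW.
Qed.

(** Turns a finite list of distinct words, as produced by enumerating a cover, into sums over the
    words of each length. *)
Lemma sum_le_tuples (G : pred (seq A)) (e : seq A -> R) (N K : nat) (s : seq (seq A)) :
  (forall w, 0 <= e w) -> uniq s -> all (fun w => size w < K)%N s ->
  \sum_(w <- s | (N <= size w)%N && G w) e w <=
  \sum_(N <= n < K) \sum_(t : n.-tuple A | G t) e t.
Proof.
move=> e0 us sK.
apply: (@le_trans _ _ (\sum_(N <= n < K) \sum_(t : n.-tuple A | G t)
    \sum_(w <- s | w == t) e t)); last first.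
  apply: ler_sum => n _; apply: ler_sum => t _.
  rewrite big_const_seq iter_addr_0 count_uniq_mem//; by case: (_ \in _).
rewrite [leRHS](eq_bigr (fun n =>
  \sum_(w <- s) \sum_(t : n.-tuple A | G t && (w == t)) e t)); last first.
  by move=> n _; rewrite (exchange_big_dep xpredT).
rewrite [leRHS](exchange_big_dep xpredT)//= big_seq_cond [leRHS]big_seq.
rewrite big_mkcondr /=; apply: ler_sum => w ws; case: ifP => [/andP[Nw Gw]|_]; last first.
  by apply: sumr_ge0 => n _; apply: sumr_ge0.
have wK := allP sK _ ws.
rewrite (bigD1_seq (size w)) ?mem_index_iota ?Nw ?iota_uniq//=.
rewrite (bigD1 (in_tuple w))/= ?Gw ?eqxx// -addrA lerDl addr_ge0//.
  exact: sumr_ge0.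
by apply: sumr_ge0 => n _; apply: sumr_ge0.
Qed.

(* Borel-Cantelli: [L] lies in the limsup set of the cylinders of [G]. *)
Lemma hausdorff_measure_null (G : pred (seq A)) (L : set (sft M)) (s q : R) (N0 : nat) :
  0 <= s -> 0 < q < 1 ->
  (forall x, L x -> exists N, forall n, (N <= n)%N -> G (block x 0 n)) ->
  (forall n, (N0 <= n)%N -> \sum_(t : n.-tuple A | G t) expR (s * wb t) <= q ^+ n) ->
  hausdorff_measure (distu u) s L = 0.
Proof.
move=> s0 /andP[q0 q1] LG Gq; apply: hausdorff_measure_eq0 => delta eta delta0 eta0.
have [N [N0N Nd Ne]] : exists N, [/\ (N0 <= N)%N,
    expR (- (N%:R * c)) <= delta & q ^+ N / (1 - q) <= eta].
  have : (fun n => 1 * q ^+ n) @ \oo --> 0.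
    by apply: cvg_geometric; rewrite ger0_norm// ltW.
  move=> /cvgr0_norm_lt/(_ (eta * (1 - q))).
  rewrite mulr_gt0 ?subr_gt0// => /(_ isT)[n1 _ n1P].
  have : (fun n => 1 * expR (- c) ^+ n) @ \oo --> 0.
    by apply: cvg_geometric; rewrite ger0_norm ?expR_ge0// expR_lt1 oppr_lt0.
  move=> /cvgr0_norm_lt/(_ delta delta0)[n2 _ n2P].
  exists (maxn N0 (maxn n1 n2)); split; first by rewrite leq_maxl.
    rewrite -mulrN expRM_natl -[leLHS]mul1r; apply: ltW.
    apply: le_lt_trans (ler_norm _) _.
    by apply: n2P => /=; lia.
  rewrite ler_pdivrMr ?subr_gt0// -[leLHS]mul1r; apply: ltW.
  apply: le_lt_trans (ler_norm _) _.
  by apply: n1P => /=; lia.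
(* The cover consists of the cylinders of all words in [G] of length at least [N], enumerated by
   their codes; the other codes give the empty set, whose gauge is [0]. *)
pose good w := (N <= size w)%N && G w.
pose U k := if @pickle_inv (seq A) k is Some w then
  if good w then cylinder M w else set0 else set0.
have diam_le w x : good w -> cylinder M w x -> expR (wb w) <= delta.
  move=> /andP[Nw _] wx; apply: le_trans Nd; rewrite ler_expR.
  apply: le_trans (word_birkhoff_opp_le wx) _.
  by rewrite lerN2 ler_wpM2r ?ler_nat// ltW.
exists U; split.
- move=> x Lx; have [n nP] := LG x Lx.
  have gb : good (block x 0 (maxn n N)).
    by rewrite /good size_block leq_maxr nP// leq_maxl.
  exists (pickle (block x 0 (maxn n N))) => //; rewrite /U pickleK_inv gb.
  exact: cylinder_block.
- move=> k; rewrite /U; case: pickle_inv => [w|]; last first.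
    by rewrite diameter_set0 lee_fin ltW.
  case: ifP => [gw|_]; last by rewrite diameter_set0 lee_fin ltW.
  (* An empty cylinder is treated apart: its [wb] is the default [0], which gives no small bound. *)
  have [[x wx]|/forallNP nw] := pselect (exists x, cylinder M w x).
    by apply: le_trans (diameter_cylinder w) _; rewrite lee_fin (diam_le w x).
  rewrite (_ : cylinder M w = set0) ?diameter_set0 ?lee_fin ?ltW//.
  by rewrite -subset0 => x /nw.
- pose e k := if @pickle_inv (seq A) k is Some w then
    if good w then expR (s * wb w) else 0 else 0.
  apply: (@le_trans _ _ (\sum_(0 <= k <oo) (e k)%:E)%E).
    apply: lee_nneseries => [k _ _|k _]; first exact: hausdorff_gauge_ge0.
    rewrite /U /e; case: pickle_inv => [w|]; last by rewrite hausdorff_gauge_set0.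
    case: ifP => _; last by rewrite hausdorff_gauge_set0.
    exact: hausdorff_gauge_le (diameter_cylinder w).
  have e0 k : (0 <= (e k)%:E)%E.
    by rewrite lee_fin /e; case: pickle_inv => // w; case: ifP => // _; exact: expR_ge0.
  apply: lime_le; first by apply: is_cvg_nneseries.
  apply: nearW => m; rewrite sumEFin lee_fin; apply: le_trans Ne.
  pose l := pmap (@pickle_inv (seq A)) (index_iota 0 m).
  have -> : \sum_(0 <= k < m) e k = \sum_(w <- l | good w) expR (s * wb w).
    rewrite /l; elim: (index_iota 0 m) => [|k r IH]; first by rewrite !big_nil.
    rewrite big_cons IH /e /=; case: pickle_inv => [w|] /=; last by rewrite add0r.
    by rewrite big_cons; case: ifP => _; rewrite ?add0r.
  pose K := (\max_(w <- l) size w).+1.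
  apply: (@le_trans _ _ (\sum_(N <= n < K) \sum_(t : n.-tuple A | G t) expR (s * wb t))).
    apply: (@sum_le_tuples G (fun w => expR (s * wb w))) => [w||].
    - exact: expR_ge0.
    - by rewrite (pmap_uniq (@pickle_invK _)) ?iota_uniq.
    - by apply/allP => w wl; rewrite /K ltnS (@leq_bigmax_seq _ _ xpredT size).
  apply: (@le_trans _ _ (\sum_(N <= n < K) q ^+ n)).
    by apply: ler_sum_nat => n /andP[Nn _]; apply: Gq; exact: leq_trans Nn.
  have [KN|NK] := leqP K N; first by rewrite big_geq// divr_ge0 ?exprn_ge0 ?subr_ge0 ?ltW.
  rewrite -(subnKC (ltnW NK)) geometric_partial_tail.
  by apply: geometric_le_lim; rewrite ?exprn_ge0 ?ger0_norm ?ltW.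
Qed.

End DistU.

(** * Gluing words *)

Section Gluing.
Context (A : finType) (M : rel A).
Hypothesis Mtrans : sft_transitive M.

(** Finiteness of the alphabet makes the connecting words uniformly short. *)
Lemma connect_bounded : exists P (rho : A -> A -> seq A),
  forall a b, path M a (rcons (rho a b) b) /\ (size (rho a b) <= P)%N.
Proof.
have /choice[rho rhoP] (ab : A * A) : exists r, path M ab.1 (rcons r ab.2).
  exact: Mtrans.
exists (\max_ab size (rho ab))%N, (fun a b => rho (a, b)) => a b; split.
  exact: (rhoP (a, b)).
exact: leq_bigmax.
Qed.

Lemma path_glue a p c (w : seq A) q b : path M a (rcons p c) ->
  path M c w -> path M (last c w) (rcons q b) ->
  path M a (rcons (p ++ (c :: w) ++ q) b).
Proof.
rewrite rcons_cat cat_path rcons_path => /andP[-> Mc] cw wq /=.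
by rewrite Mc /= rcons_cat cat_path cw wq.
Qed.

(** Each new word is put in front and joined by a connecting word. The result is kept nonempty so
    that there is a first letter to connect to. *)
Lemma word_containing (W : set (seq A)) : (0 < #|A|)%N ->
  finite_set W -> (forall w, W w -> sorted M w) ->
  exists c w, path M c w /\ forall w', W w' -> infix w' (c :: w).
Proof.
move=> A0 /finite_seqP[s ->]; elim: s => [_|w s IH ws].
  by have /card_gt0P[a _] := A0; exists a, [::].
have [|c [w' [cw' sw']]] := IH; first by move=> v vs; apply: ws; rewrite /= inE vs orbT.
have := ws w; rewrite /= inE eqxx => /(_ isT); case: w {IH ws} => [_|d w /= dw].
  exists c, w'; split=> // v; rewrite /mkset inE => /orP[/eqP->|].
    by rewrite infix0s.
  exact: sw'.
have [rho rhoP] := Mtrans (last d w) c.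
exists d, (w ++ rho ++ c :: w'); split.
  by move: rhoP; rewrite /= rcons_path !cat_path dw /= => /andP[-> ->].
move=> v; rewrite /mkset inE => /orP[/eqP->|/sw' vw'].
  exact: (prefix_infix (d :: w)).
exact: (infix_catl (d :: w) (infix_catl rho vw')).
Qed.

Context (R : realType) (phi : sft M -> R) (D B : R).
Hypothesis phiD : distortion phi D.
Hypothesis phiB : forall x, `|phi x| <= B.
Local Notation sigma := (@Defs.shift A M).

Lemma birkhoff_cat (p q : seq A) x : birkhoff phi (size (p ++ q)) x =
  birkhoff phi (size p) x + birkhoff phi (size q) (iter (size p) sigma x).
Proof. by rewrite size_cat birkhoffD. Qed.

Lemma birkhoff_geN (n k : nat) x : (n <= k)%N -> 0 <= B ->
  - (k%:R * B) <= birkhoff phi n x.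
Proof.
move=> nk B0; have := birkhoff_norm n x phiB.
rewrite ler_norml => /andP[h _]; apply: le_trans h.
by rewrite lerN2 ler_wpM2r// ler_nat.
Qed.

(** A segment with a large sum is closed up by a connecting word. Closing costs at most [P%:R * B]
    and moving to another point of the cylinder at most [D], which leaves [1]. *)
Lemma positive_loop : 0 <= D -> 0 <= B ->
  (forall C : R, exists x n, C <= birkhoff phi n x) ->
  exists c q, path M c (rcons q c) /\
    forall y, cylinder M (c :: q) y -> 1 <= birkhoff phi (size q).+1 y.
Proof.
move=> D0 B0 phi_pos; have [P [rho rhoP]] := connect_bounded.
have [x [[|n] xn]] := phi_pos (D + P%:R * B + 1).
  have PB : 0 <= P%:R * B by rewrite mulr_ge0.
   move: xn; rewrite birkhoff0; lra.
have [w bxw] : exists w, block x 0 n.+1 = x 0%N :: w.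
  by exists (block x 1 n); rewrite -add1n block_cat.
have [rP rs] := rhoP (last (x 0%N) w) (x 0%N).
exists (x 0%N), (w ++ rho (last (x 0%N) w) (x 0%N)); split.
  have := block_sorted x 0 n.+1; rewrite bxw /= => xw.
  by rewrite rcons_cat cat_path xw.
move=> y; rewrite -cat_cons -bxw => /cylinder_cat[xy _].
have -> : (size (w ++ rho (last (x 0%N) w) (x 0%N))).+1 =
          (n.+1 + size (rho (last (x 0%N) w) (x 0%N)))%N.
  by rewrite size_cat -addSn -[(size w).+1]/(size (x 0%N :: w)) -bxw size_block.
rewrite birkhoffD.
have := birkhoff_geN (iter n.+1 sigma y) rs B0.
move: xy; rewrite /cylinder /mkset size_block => /phiD.
by rewrite ler_norml => /andP[]; lra.
Qed.

(** The bound holds at every point of the cylinder of the loop, so repetition accumulates no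
    distortion. The preceding letter [a] varies because after one turn it becomes [last c q]. *)
Lemma loop_power c q : path M c (rcons q c) ->
  (forall y, cylinder M (c :: q) y -> 1 <= birkhoff phi (size q).+1 y) ->
  forall j a, M a c -> let w := iter j (cat (c :: q)) [::] in
  [/\ path M a (rcons w c), size w = (j * (size q).+1)%N &
  forall y, cylinder M w y -> j%:R <= birkhoff phi (size w) y].
Proof.
move=> cq hq; elim=> [|j IH] a ac /=.
  by split; rewrite ?ac// => y _; rewrite birkhoff0.
move: cq; rewrite rcons_path => /andP[cq qc].
have [h1 h2 h3] := IH _ qc.
split; first by rewrite ac rcons_cat cat_path cq.
  by rewrite size_cat h2 mulSn.
move=> y; rewrite -cat_cons => /cylinder_cat[/hq ly /h3 hy].
rewrite -[(size _).+1]/(size ((c :: q) ++ iter j (cat (c :: q)) [::])).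
by rewrite birkhoff_cat -natr1 addrC lerD.
Qed.

(** The tail is [pre], which contains all of [W], then [m + J] turns of the loop, then [post]
    leading to [b]. Of the turns, [J] pay for [pre] and [post], and the length stays linear in
    [m]. *)
Lemma tails (W : set (seq A)) : (0 < #|A|)%N ->
  finite_set W -> (forall w, W w -> sorted M w) ->
  0 <= D -> 0 <= B -> (forall C : R, exists x n, C <= birkhoff phi n x) ->
  exists L : nat, forall a b m, exists t,
   [/\ path M a (rcons t b), (size t <= L * m.+1)%N, forall w, W w -> infix w t &
    forall y, cylinder M t y -> m%:R <= birkhoff phi (size t) y].
Proof.
move=> A0 Wfin WM D0 B0 phi_pos.
have [P [rho rhoP]] := connect_bounded.
have [d [w [dw Ww]]] := word_containing A0 Wfin WM.
have [c [q [cq hq]]] := positive_loop D0 B0 phi_pos.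
(* Bounds [pre] and [post] together: three connecting words, [d :: w] and the letter [c]. *)
pose K := (size w + P + P + P + 2)%N.
pose J := Num.Def.archi_bound (K%:R * B + K%:R * B).
have JP : K%:R * B + K%:R * B <= J%:R.
  apply: ltW; apply: le_lt_trans (archi_boundP _); rewrite ?addr_ge0 ?mulr_ge0//.
exists (K + J.+1 * (size q).+1)%N => a b m.
pose pre := rho a d ++ (d :: w) ++ rho (last d w) c.
pose post := c :: rho c b.
have pre_path : path M a (rcons pre c).
  by apply: path_glue => //; [have [] := rhoP a d|have [] := rhoP (last d w) c].
have /andP[pa prec] : path M a pre && M (last a pre) c by rewrite -rcons_path.
have [ph ps pb] := loop_power cq hq (m + J) prec.
set pw := iter _ _ _ in ph ps pb.
have [_ s1] := rhoP a d; have [_ s2] := rhoP (last d w) c; have [s3p s3] := rhoP c b.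
have spre : (size pre <= K)%N by rewrite /pre !size_cat /= /K; lia.
have spost : (size post <= K)%N by rewrite /post /= /K; lia.
exists (pre ++ (pw ++ post)); split.
- rewrite rcons_cat cat_path pa rcons_cat cat_path.
  by move: ph; rewrite rcons_path => /andP[-> Mc] /=; rewrite Mc.
- have sp : (size pre + size post <= K)%N by rewrite /pre !size_cat /= /K; lia.
  by rewrite size_cat size_cat ps; nia.
- move=> w' /Ww ww'; rewrite /pre -!catA; apply: infix_catl.
  exact: infix_catr.
- move=> y /cylinder_cat[_ /cylinder_cat[/pb hpw _]].
  rewrite birkhoff_cat birkhoff_cat.
  have := birkhoff_geN y spre B0.
  have := birkhoff_geN (iter (size pw) sigma (iter (size pre) sigma y)) spost B0.
  by move: hpw JP; rewrite natrD; lra.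
Qed.

End Gluing.

(** * The Cantor set *)

Section Cantor.
Context (R : realType) (A : finType) (M : rel A).
Local Notation sigma := (@Defs.shift A M).
Context (phi : sft M -> R) (I : finType) (b : A) (w : I -> seq A).
Context (n H : nat) (tail : bool -> A -> seq A).
Hypothesis w_inj : injective w.
Hypothesis w_size : forall i, size (w i) = n.
Hypothesis w_path : forall i, path M b (w i).
Hypothesis tail_path : forall s a, path M a (rcons (tail s a) b).
Hypothesis tail_size : forall s a, (size (tail s a) <= H)%N.

(** Tested on the word alone, so that the next tail can be chosen before the limit point exists.
    Under distortion [D], the sum is at most [D] on the whole cylinder where the test holds, and
    positive there where it fails. *)
Definition low_sum (acc : seq A) : bool :=
  `[< exists y, cylinder M acc y /\ birkhoff phi (size acc) y <= 0 >].

(* The sign of the tail steers the Birkhoff sum of [phi] back towards [0]. *)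
Definition add_word (acc : seq A) (i : I) : seq A :=
  acc ++ (b :: w i) ++ tail (low_sum acc) (last b (w i)).

Definition path_word (p : seq I) : seq A := foldl add_word [::] p.

Lemma path_word_rcons p i : path_word (rcons p i) = add_word (path_word p) i.
Proof. by rewrite /path_word -cats1 foldl_cat. Qed.

Lemma path_word_sorted p : sorted M (rcons (path_word p) b).
Proof.
elim/last_ind: p => // p i; rewrite path_word_rcons /add_word.
case: (path_word p) => [_|a acc] /=; last by move=> h; apply: path_glue.
by rewrite rcons_cat cat_path w_path tail_path.
Qed.

Lemma size_add_word acc i : (size acc < size (add_word acc i) <= size acc + (n.+1 + H))%N.
Proof.
rewrite /add_word !size_cat /= w_size.
by have := tail_size (low_sum acc) (last b (w i)); lia.
Qed.

Lemma path_word_size p : (size p <= size (path_word p))%N.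
Proof.
elim/last_ind: p => // p i IH; rewrite path_word_rcons size_rcons.
by have := size_add_word (path_word p) i; lia.
Qed.

Lemma path_word_mkseq xi j :
  path_word (mkseq xi j.+1) = add_word (path_word (mkseq xi j)) (xi j).
Proof. by rewrite mkseqS path_word_rcons. Qed.

Lemma path_word_prefix xi j k :
  prefix (path_word (mkseq xi j)) (path_word (mkseq xi (j + k))).
Proof.
elim: k => [|k IH]; first by rewrite addn0 prefix_refl.
by rewrite addnS path_word_mkseq /add_word; apply: prefix_trans IH (prefix_prefix _ _).
Qed.

Lemma path_word_nth xi j k i : (i < size (path_word (mkseq xi j)))%N ->
  (i < size (path_word (mkseq xi k)))%N ->
  nth b (path_word (mkseq xi j)) i = nth b (path_word (mkseq xi k)) i.
Proof.
have aux j' k' : (j' <= k')%N -> (i < size (path_word (mkseq xi j')))%N ->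
    nth b (path_word (mkseq xi j')) i = nth b (path_word (mkseq xi k')) i.
  move=> /subnKC <- ij; have /prefixP[s ->] := path_word_prefix xi j' (k' - j').
  by rewrite nth_cat ij.
by move=> ij ik; case: (leqP j k) => [|/ltnW] jk; [|symmetry]; apply: aux.
Qed.

Lemma path_point xi : exists x : sft M, forall j, cylinder M (path_word (mkseq xi j)) x.
Proof.
(* Each block has at least one letter, so [k.+1] blocks determine the letter of index [k]. *)
pose x k := nth b (path_word (mkseq xi k.+1)) k.
have xE k j : (k < size (path_word (mkseq xi j)))%N ->
      x k = nth b (path_word (mkseq xi j)) k.
  move=> kj; apply: path_word_nth => //.
  by have := path_word_size (mkseq xi k.+1); rewrite size_mkseq.
have xM k : M (x k) (x k.+1).
  have := path_word_size (mkseq xi k.+2); rewrite size_mkseq => sz.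
  rewrite (xE k k.+2) 1?ltnW// (xE k.+1 k.+2)//.
  have := path_word_sorted (mkseq xi k.+2).
  move=> /(sortedP b)/(_ k); rewrite size_rcons ltnS => /(_ (ltnW sz)).
  by rewrite !nth_rcons sz (ltnW sz).
exists (Sft xM) => j; rewrite /cylinder /mkset.
apply: (@eq_from_nth _ b); rewrite ?size_block// => k kj.
by rewrite nth_mkseq// add0n /= (xE k j).
Qed.

Section Point.
Context (xi : nat -> I) (x : sft M).
Hypothesis xP : forall j, cylinder M (path_word (mkseq xi j)) x.
Let N j := size (path_word (mkseq xi j)).

Lemma path_split j : let acc := path_word (mkseq xi j) in
  let t := tail (low_sum acc) (last b (w (xi j))) in
  [/\ N j.+1 = (N j + (n.+1 + size t))%N,
      cylinder M (b :: w (xi j)) (iter (N j) sigma x) &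
      cylinder M t (iter n.+1 sigma (iter (N j) sigma x))].
Proof.
move=> acc t; have := xP j.+1; rewrite path_word_mkseq -/acc /add_word -/t.
move=> /cylinder_cat[_ /cylinder_cat[h1 h2]]; split => //.
  by rewrite /N path_word_mkseq /add_word !size_cat /= w_size.
by move: h2; rewrite /= w_size.
Qed.

Lemma next_block k : exists j, (k <= N j <= k + (n.+1 + H))%N.
Proof.
elim: k => [|k [j /andP[kj jk]]]; first by exists 0%N.
have [kNj|Njk] := ltnP k (N j); first by exists j; lia.
exists j.+1; rewrite /N path_word_mkseq.
by have := size_add_word (path_word (mkseq xi j)) (xi j); rewrite -/(N j); lia.
Qed.

(** A window of twice the maximal block length meets a block boundary in its first half, and the
    block that starts there, with its tail, fits in the window. *)
Lemma path_frequent (W : set (seq A)) :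
  (forall s a w', W w' -> infix w' (tail s a)) -> frequent M W x.
Proof.
move=> tail_infix.
exists ((n.+1 + H) + (n.+1 + H))%N => // k _ w' Ww'.
have [j /andP[kj jk]] := next_block k.
have [Nj _] := path_split j; set t := tail _ _ in Nj *.
rewrite /cylinder /mkset !block_shift !addn0 => tE.
have tH : (size t <= H)%N by exact: tail_size.
have -> : (n.+1 + H + (n.+1 + H) = (N j - k + n.+1) + (size t +
    (n.+1 + H + (n.+1 + H) - (N j - k + n.+1) - size t)))%N by lia.
rewrite block_cat; apply: infix_catl; rewrite block_cat; apply: infix_catr.
have -> : (k + (N j - k + n.+1) = N j + n.+1)%N by lia.
by rewrite tE; apply: tail_infix.
Qed.

Context (D B : R) (m : nat).
Hypothesis D0 : 0 <= D.
Hypothesis B0 : 0 <= B.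
Hypothesis phiD : distortion phi D.
Hypothesis phiB : forall x, `|phi x| <= B.
Hypothesis w_phi : forall i y, cylinder M (b :: w i) y ->
  `|birkhoff phi n.+1 y| <= m%:R.
Hypothesis tail_phi : forall (s : bool) a y, cylinder M (tail s a) y ->
  m%:R <= (if s then 1 else -1) * birkhoff phi (size (tail s a)) y.

(** Since the tail outweighs the word, each block moves the sum in the direction of its tail, by at
    most [(n.+1 + H)%:R * B]. The sum goes up only from a value at most [D], and down only from a
    positive value. *)
Lemma path_birkhoff j : `|birkhoff phi (N j) x| <= D + (n.+1 + H)%:R * B.
Proof.
have E0 : 0 <= (n.+1 + H)%:R * B by rewrite mulr_ge0.
elim: j => [|j IH]; first by rewrite birkhoff0 normr0 addr_ge0.
have [-> h1 h2] := path_split j; set t := tail _ _ in h2 *.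
have tH : (n.+1 + size t <= n.+1 + H)%N by rewrite leq_add2l tail_size.
rewrite birkhoffD; set y := iter (N j) _ _ in h1 h2 *.
have yB : `|birkhoff phi (n.+1 + size t) y| <= (n.+1 + H)%:R * B.
  by apply: le_trans (birkhoff_norm _ _ phiB) _; rewrite ler_wpM2r// ler_nat.
have := tail_phi h2; rewrite -/t; have := w_phi h1.
have -> : birkhoff phi (n.+1 + size t) y = birkhoff phi n.+1 y +
  birkhoff phi (size t) (iter n.+1 sigma y) by rewrite birkhoffD.
move: yB; rewrite birkhoffD; move: IH; rewrite !ler_norml.
move: ((n.+1 + H)%:R * B) (m%:R) E0 => E m' E0.
move=> /andP[IH1 IH2] /andP[yB1 yB2] /andP[w1 w2].
case: (boolP (low_sum _)) => [/asboolP[z [zj z0]]|/asboolPn nz];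
  rewrite ?mul1r ?mulN1r => ht.
  have := phiD (etrans zj (esym (xP j))); rewrite ler_norml -/(N j) => /andP[].
  by move: z0; rewrite -/(N j) => ? ? ?; apply/andP; split; lra.
have x0 : 0 < birkhoff phi (N j) x.
  by rewrite ltNge; apply/negP => x0; apply: nz; exists x.
by move: D0 => ?; apply/andP; split; lra.
Qed.

Lemma path_birkhoff_bounded k :
  `|birkhoff phi k x| <= D + (n.+1 + H)%:R * B + (n.+1 + H)%:R * B.
Proof.
have [j /andP[kj jk]] := next_block k.
have := path_birkhoff j; rewrite -(subnKC kj) birkhoffD.
set y := iter _ _ _.
have : `|birkhoff phi (N j - k) y| <= (n.+1 + H)%:R * B.
  apply: le_trans (birkhoff_norm _ _ phiB) _; rewrite ler_wpM2r// ler_nat.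
  by rewrite leq_subLR.
by rewrite !ler_norml => /andP[? ?] /andP[? ?]; apply/andP; split; lra.
Qed.

End Point.

(** * Lower bound for the Hausdorff measure of the Cantor set *)

Context (u : sft M -> R) (Du Bu c : R).
Hypothesis Du0 : 0 <= Du.
Hypothesis uD : distortion (fun z => - u z) Du.
Hypothesis c0 : 0 < c.
Hypothesis uc : forall x, c <= u x.
Hypothesis uB : forall x, `|u x| <= Bu.
Let wb := word_birkhoff (fun z => - u z).

Let uB' x : - Bu <= - u x <= 0.
Proof.
have := uB x; rewrite ler_norml => /andP[_ ?]; have := uc x; move: c0 => ? ?.
by apply/andP; split; lra.
Qed.

Lemma birkhoff_opp_ge k x : - (k%:R * Bu) <= birkhoff (fun z => - u z) k x.
Proof. by rewrite -mulrN; apply: birkhoff_ge => y; have /andP[] := uB' y. Qed.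

Lemma birkhoff_opp_le0 k x : birkhoff (fun z => - u z) k x <= 0.
Proof. by apply: sumr_le0 => y _; have /andP[] := uB' (iter y sigma x). Qed.

Lemma wb_le0 v x : cylinder M v x -> wb v <= 0.
Proof. by move=> vx; apply: (word_birkhoff_le vx) => y _; exact: birkhoff_opp_le0. Qed.

(** The loss is the same for all [p] and [i]: one distortion constant for each of the two words and
    at most [H%:R * Bu] for the tail. *)
Lemma wb_add_word p i : wb (path_word p) + wb (b :: w i) - (Du + Du + H%:R * Bu)
  <= wb (path_word (rcons p i)).
Proof.
pose xi := nth i p.
have pE : mkseq xi (size p) = p by rewrite mkseq_nth.
have xiE : xi (size p) = i by rewrite /xi nth_default.
have [x xP] := path_point xi.
have := xP (size p); rewrite pE => px.
have := xP (size p).+1; rewrite mkseqS pE xiE => pix.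
have [] := path_split xP (size p); rewrite pE xiE; set t := tail _ _ => Nt h1 h2.
apply: le_trans (word_birkhoff_ge uD pix).
have -> : size (path_word (rcons p i)) = (size (path_word p) + (n.+1 + size t))%N.
  by rewrite -Nt mkseqS pE xiE.
rewrite birkhoffD birkhoffD.
have := word_birkhoff_near uD px; have := word_birkhoff_near uD h1.
have := birkhoff_opp_ge (size t) (iter n.+1 sigma (iter (size (path_word p)) sigma x)).
have tB : (size t)%:R * Bu <= H%:R * Bu.
  rewrite ler_wpM2r ?ler_nat ?tail_size//.
  exact: le_trans (uB x).
rewrite /= w_size -/wb; lra.
Qed.

(** As [w] is injective, the points separate within [n.+1] letters after the common word, so their
    distance is at least the weight of that word up to a constant factor. *)
Lemma path_dist xi xi' x x' j :
  (forall k, cylinder M (path_word (mkseq xi k)) x) ->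
  (forall k, cylinder M (path_word (mkseq xi' k)) x') ->
  mkseq xi j = mkseq xi' j -> xi j <> xi' j ->
  expR (wb (path_word (mkseq xi j)) - (Du + n.+1%:R * Bu)) <= distu u x x'.
Proof.
move=> xP xP' e ne.
set q := path_word (mkseq xi j).
have [_ h1 _] := path_split xP j; have [_ h2 _] := path_split xP' j.
have nb : block x 0 (size q + n.+1) <> block x' 0 (size q + n.+1).
  rewrite !block_cat => /eqP; rewrite eqseq_cat ?size_block// => /andP[_ /eqP].
  move: h1 h2; rewrite /cylinder /mkset /= !w_size !block_shift !addn0 -e -/q !add0n.
  by move=> -> -> [] /w_inj.
have xx' : x <> x' by move=> xx'; apply: nb; rewrite xx'.
rewrite /distu; case: asboolP => // _; rewrite ler_expR /wedge.
have [ew _] := wedge_lengthP xx'.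
have lew : (wedge_length x x' <= size q + n.+1)%N.
  rewrite leqNgt; apply/negP => lt; apply: nb; apply/block_inj => i ilt.
  by move/block_inj : ew; apply; exact: ltn_trans lt.
apply: le_trans (word_birkhoff_ge uD (cylinder_block _ _)); rewrite size_block.
have := word_birkhoff_near uD (xP j); rewrite -/q -/wb.
have := birkhoff_opp_ge n.+1 (iter (size q) sigma x).
set l := wedge_length x x' in lew *; set k := (size q + n.+1 - l)%N.
have := birkhoff_opp_le0 k (iter l sigma x).
have := birkhoffD (fun z => - u z) l k x.
rewrite /k subnKC// birkhoffD; lra.
Qed.

(** The weights [wt] do not decrease from a node to the sum over its children, because the total
    weight of the words compensates the loss of each step. A cheap cover of [E] would give nodes
    [Q k] of total weight below that of the root, and [tree_cover] would find a path avoiding them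
    all, although its point is covered. *)
Lemma hausdorff_measure_cantor (r0 r : R) (E : set (sft M)) : 0 <= r0 <= r -> 0 < r ->
  expR (r * (Du + Du + H%:R * Bu)) <= \sum_i expR (r * wb (b :: w i)) ->
  (forall xi x, (forall j, cylinder M (path_word (mkseq xi j)) x) -> E x) ->
  hausdorff_measure (distu u) r0 E <> 0.
Proof.
move=> /andP[r00 r0r] rpos sum_big KE.
have [i0 _] : exists i : I, true.
  apply: contrapT => /forallNP noI; move: sum_big.
  rewrite big1 => [|i]; last by have := noI i.
  by rewrite leNgt expR_gt0.
have /choice[X XP] := path_point.
pose K := r * (Du + n.+1%:R * Bu).
pose wt p := expR (r * wb (path_word p)).
have Bu0 : 0 <= Bu by apply: le_trans (uB (X (fun=> i0))).
(* The root has weight [1]: half of it bounds [expR K] times the gauges, the other half the sum of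
   the errors [2^-1 / (2 ^ k.+1)%:R]. *)
apply: (@hausdorff_measure_neq0 _ _ _ _ _ (expR (- K) / 2)).
  by rewrite divr_gt0// expR_gt0.
move=> U EU; rewrite leNgt; apply/negP => small.
have /choice[Q QP] k : exists q : seq I,
   (forall xi, U k (X xi) -> mkseq xi (size q) = q) /\
   ((wt q)%:E <= (expR K)%:E * hausdorff_gauge (distu u) r0 (U k) +
                (2^-1 / (2 ^ k.+1)%:R)%:E)%E.
  have eta0 : 0 < 2^-1 / (2 ^ k.+1)%:R :> R by rewrite divr_gt0// ltr0n expn_gt0.
  (* If two paths with points in [U k] differ, [Q k] is the longest common prefix of all such
     paths. *)
  have [ex|nex] := pselect (exists j,
    `[< exists xi xi', [/\ U k (X xi), U k (X xi') & xi j <> xi' j] >]).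
    case: (ex_minnP ex) => j /asboolP[xi [xi' [Ux Ux' ne]]] min.
    have agree xi1 : U k (X xi1) -> mkseq xi j = mkseq xi1 j.
      move=> U1; apply: (@eq_from_nth _ i0); rewrite ?size_mkseq// => i ij.
      rewrite !nth_mkseq//; apply: contrapT => nei.
      have := min i; rewrite leqNgt ij => /implyP; rewrite implybF => /asboolPn.
      by apply; exists xi, xi1.
    exists (mkseq xi j); split=> [xi1 U1|]; first by rewrite size_mkseq -agree.
    apply: (@le_trans _ _
      ((expR K)%:E * hausdorff_gauge (distu u) r0 (U k))%E); last first.
      by rewrite leeDl// lee_fin ltW.
    set a := wb (path_word (mkseq xi j)) - (Du + n.+1%:R * Bu).
    have ad := path_dist (XP xi) (XP xi') (agree _ Ux') ne.
    have a0 : a <= 0.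
      rewrite /a subr_le0; apply: (@le_trans _ _ 0); last by rewrite addr_ge0// mulr_ge0.
      exact: (wb_le0 (XP xi j)).
    apply: (@le_trans _ _ ((expR K)%:E * (expR (r0 * a))%:E)%E); last first.
      apply: lee_wpmul2l; first by rewrite lee_fin expR_ge0.
      exact: hausdorff_gauge_ge Ux Ux' ad.
    rewrite -EFinM lee_fin -expRD ler_expR.
    (* [a] is nonpositive and [r0 <= r]. The gauge exponent [r0] may be [0], while the weights need
       [r > 0] to decay along paths. *)
    have : r * a <= r0 * a by apply: ler_wnM2r.
    by rewrite /K /a !mulrBr; lra.
  (* At most one path has its point in [U k], and a long enough prefix of it weighs less than the
     error term. If there is none, any path will do. *)
  have [xi xiP] : exists xi, forall xi1, U k (X xi1) -> forall j, xi1 j = xi j.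
    have [[xi Ux]|nU] := pselect (exists xi, U k (X xi)).
      exists xi => xi1 U1 j; apply: contrapT => ne; apply: nex; exists j.
      by apply/asboolP; exists xi1, xi.
    by exists (fun=> i0) => xi1 U1; exfalso; apply: nU; exists xi1.
  have : (fun j => 1 * expR (- (r * c)) ^+ j) @ \oo --> 0.
    by apply: cvg_geometric; rewrite ger0_norm ?expR_ge0// expR_lt1 oppr_lt0 mulr_gt0.
  move=> /cvgr0_norm_lt/(_ _ eta0)[j _ /(_ j (leqnn j))] /=.
  rewrite mul1r ger0_norm ?exprn_ge0 ?expR_ge0// => hj.
  exists (mkseq xi j); split=> [xi1 U1|].
    by rewrite size_mkseq; apply: eq_mkseq => i; apply: xiP.
  apply: (@le_trans _ _ (2^-1 / (2 ^ k.+1)%:R)%:E); last first.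
    by rewrite leeDr// mule_ge0 ?hausdorff_gauge_ge0// lee_fin expR_ge0.
  rewrite lee_fin; apply: le_trans (ltW hj).
  rewrite -expRM_natl ler_expR mulrN mulrCA -mulrN.
  rewrite ler_pM2l//; apply: le_trans (word_birkhoff_opp_le uc (XP xi j)) _.
  rewrite lerN2 ler_wpM2r ?ler_nat ?(ltW c0)//.
  by have := path_word_size (mkseq xi j); rewrite size_mkseq.
have [|p||xi xiP] := @tree_cover R I wt Q; last first.
- have [k _ Uk] := EU _ (KE _ _ (XP xi)).
  by apply: (xiP k); have [h _] := QP k; apply: h.
- apply: (@le_lt_trans _ _ (\sum_(0 <= k <oo) ((expR K)%:E *
    hausdorff_gauge (distu u) r0 (U k) + (2^-1 / (2 ^ k.+1)%:R)%:E))%E).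
    apply: lee_nneseries => [k _ _|k _]; first by rewrite lee_fin expR_ge0.
    by have [] := QP k.
  apply: (@le_lt_trans _ _ (\sum_(0 <= k <oo) ((expR K)%:E *
    hausdorff_gauge (distu u) r0 (U k)) + 2^-1%:E)%E).
    apply: epsilon_trick => // k.
    by rewrite mule_ge0 ?hausdorff_gauge_ge0// lee_fin expR_ge0.
  rewrite nneseriesZl => [|k _]; last exact: hausdorff_gauge_ge0.
  have -> : wt [::] = 2^-1 + 2^-1.
    have [x xP] := path_point (fun=> i0).
    have wb0 : wb [::] = 0.
      apply/eqP; rewrite eq_le (wb_le0 (xP 0%N)).
      by have := word_birkhoff_ge uD (xP 0%N); rewrite birkhoff0.
    by rewrite /wt wb0 mulr0 expR0; lra.
  rewrite EFinD lteD2rE//.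
  have -> : (2^-1%:E = (expR K)%:E * (expR (- K) / 2)%:E :> \bar R)%E.
    by rewrite -EFinM mulrA -expRD subrr expR0 mul1r.
  by rewrite lte_pmul2l// lte_fin expR_gt0.
- move: sum_big; set loss := r * _ => sum_big.
  have -> : wt p = expR (- loss) * wt p * expR loss.
    by rewrite mulrAC -expRD addNr expR0 mul1r.
  apply: (@le_trans _ _ (expR (- loss) * wt p * \sum_i expR (r * wb (b :: w i)))).
    by rewrite ler_wpM2l// mulr_ge0// expR_ge0.
  rewrite mulr_sumr; apply: ler_sum => i _; rewrite /wt -!expRD ler_expR.
  by rewrite /loss -mulrN -!mulrDr ler_pM2l//; have := wb_add_word p i; lra.
- by move=> p; exact: expR_ge0.
Qed.

End Cantor.

(** * Level sets *)

Lemma limn_einf_lt (R : realType) (a : nat -> R) (l : R) :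
  (limn_einf (fun n => (a n)%:E) < l%:E)%E ->
  exists2 e, 0 < e & forall N, exists2 n, (N <= n)%N & a n < l - e.
Proof.
move=> al; apply: contrapT => noe.
have {}noe e : 0 < e -> exists N, forall n, (N <= n)%N -> l - e <= a n.
  move=> e0; apply: contrapT => /forallNP noN; apply: noe; exists e => // N.
  have /existsNP[n /not_implyP[Nn an]] := noN N; exists n => //.
  by rewrite ltNge; apply/negP.
move: al; rewrite ltNge => /negP; apply; apply/lee_subgt0Pr => e /noe[N aN].
rewrite limn_einf_lim (cvg_lim _ (cvg_einfs_sup (u := fun n => (a n)%:E)))//.
apply: le_ereal_sup_tmp; exists (einfs (fun n => (a n)%:E) N); first by exists N.
by apply: le_ereal_inf_tmp => _ [n Nn <-]; rewrite lee_fin; apply: aN.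
Qed.

Section Growth.
Context (R : realType) (A : finType) (M : rel A) (psi v : sft M -> R).
Context (alpha cv : R).
Hypothesis cv0 : 0 < cv.
Hypothesis vcv : forall x, v x <= - cv.
Let phi x := psi x - alpha * v x.

Let birkhoff_v_le n x : birkhoff v n x <= - (n%:R * cv).
Proof.
rewrite -[X in X <= _]opprK lerN2 -birkhoffN; apply: birkhoff_ge => z.
by have := vcv z; lra.
Qed.

Let birkhoff_v_lt0 n x : (0 < n)%N -> birkhoff v n x < 0.
Proof.
by move=> n0; apply: le_lt_trans (birkhoff_v_le n x) _; rewrite oppr_lt0 mulr_gt0// ltr0n.
Qed.

Lemma birkhoff_ratio n x : (0 < n)%N ->
  birkhoff phi n x = (birkhoff psi n x / birkhoff v n x - alpha) * birkhoff v n x.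
Proof.
move=> n0; rewrite birkhoff_lin mulrBl divfK//.
by rewrite lt_eqF// birkhoff_v_lt0.
Qed.

(** As [v] is negative, ratios below [alpha - e] give sums of [phi] of at least [n%:R * (e * cv)],
    and such [n] are arbitrarily large. *)
Lemma unbounded_above : (alpha_minus psi v < alpha%:E)%E ->
  forall C, exists x n, C <= birkhoff phi n x.
Proof.
move=> /ereal_inf_lt[_ [x _ <-]] /limn_einf_lt[e e0 small] C; exists x.
have [n Nn an] := small (Num.Def.archi_bound (C / (e * cv))).+1.
exists n; have n0 : (0 < n)%N by exact: leq_ltn_trans Nn.
have Cn : C <= n%:R * (e * cv).
  rewrite -ler_pdivrMr ?mulr_gt0//; apply: le_trans (ler_norm _) _.
  apply: (@le_trans _ _ (Num.Def.archi_bound (C / (e * cv)))%:R).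
    rewrite ltW//; have := archi_boundP (normr_ge0 (C / (e * cv))).
    by rewrite /Num.Def.archi_bound normr_id.
  by rewrite ler_nat ltnW.
apply: le_trans Cn _; rewrite birkhoff_ratio//.
have := birkhoff_v_le n x; have := birkhoff_v_lt0 x n0.
move: an; move: (birkhoff v n x) (_ / _) => Sv a an Sv0 Svn.
have : 0 <= (- Sv) * (- (a - alpha) - e) by apply: mulr_ge0; lra.
have : 0 <= e * (- Sv - n%:R * cv) by apply: mulr_ge0 (ltW e0) _; lra.
nra.
Qed.

Lemma level_set_sublinear x Bv e : 0 < e -> 0 < Bv -> (forall y, `|v y| <= Bv) ->
  level_set psi v alpha x ->
  exists N, forall n, (N <= n)%N -> `|birkhoff phi n x| <= e * n%:R.
Proof.
move=> e0 Bv0 vB /cvgrPdist_lt/(_ (e / Bv)); rewrite divr_gt0// => /(_ isT)[N _ hN].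
exists N.+1 => n Nn; have n0 : (0 < n)%N by exact: leq_ltn_trans Nn.
rewrite birkhoff_ratio// normrM distrC.
have := hN n (ltnW Nn) => /= /ltW h.
apply: le_trans (ler_pM _ _ h (birkhoff_norm n x vB)) _ => //.
by rewrite mulrCA divfK ?gt_eqF// mulrC.
Qed.

(** A bounded quantity divided by [birkhoff v n x], whose size grows at least linearly, tends to
    [0]. *)
Lemma uniform_level_set_sub : uniform_level_set psi v alpha `<=` level_set psi v alpha.
Proof.
move=> x xUL.
have [C C0 hC] : exists2 C : R, 0 < C & forall n, (0 < n)%N -> `|birkhoff phi n x| <= C.
  have [C supC] : exists C : R,
      (ereal_sup [set `|birkhoff psi n x - alpha * birkhoff v n x|%:E |
      n in [set n : nat | (0 < n)%N]] <= C%:E)%E.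
    move: xUL; rewrite /uniform_level_set /mkset; case: ereal_sup => [c _|//|_].
      by exists c.
    by exists 0; rewrite leNye.
  exists (`|C| + 1) => [|n n0]; first by rewrite ltr_wpDl.
  apply: (@le_trans _ _ C); last by have := ler_norm C; lra.
  rewrite birkhoff_lin -lee_fin; apply: le_trans supC; apply: ereal_sup_ubound.
  by exists n.
apply/cvgrPdist_lt => e e0; near=> n.
have n0 : (0 < n)%N by near: n; exists 1%N.
have Sv0 := birkhoff_v_lt0 x n0.
rewrite distrC -(ltr_pM2r (_ : 0 < `|birkhoff v n x|)) ?normr_gt0 ?lt_eqF//.
rewrite -normrM -birkhoff_ratio//; apply: le_lt_trans (hC n n0) _.
rewrite ltr0_norm//.
apply: (@lt_le_trans _ _ (e * (n%:R * cv))); last first.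
  by rewrite ler_pM2l//; have := birkhoff_v_le n x; lra.
rewrite mulrCA -ltr_pdivrMr ?mulr_gt0//.
by near: n; exact: nbhs_infty_gtr.
Unshelve. all: by end_near.
Qed.

End Growth.

(** Replacing [psi] and [alpha] by their negatives turns the upper boundary value into the lower
    one. *)
Lemma unbounded_below (R : realType) (A : finType) (M : rel A)
    (psi v : sft M -> R) (alpha cv : R) :
  0 < cv -> (forall x, v x <= - cv) ->
  (alpha%:E < alpha_plus psi v)%E ->
  forall C, exists x n, C <= birkhoff (fun z => - (psi z - alpha * v z)) n x.
Proof.
move=> cv0 vcv al C.
have al' : (alpha_minus (fun z => - psi z)%R v < (- alpha)%:E)%E.
  move: al; rewrite /alpha_plus => /ereal_sup_gt[_ [x _ <-]] al.
  apply: (@le_lt_trans _ _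
    (limn_einf (fun n =>
      (birkhoff (fun z => - psi z) n x / birkhoff v n x)%:E))).
    by apply: ereal_inf_lbound; exists x.
  rewrite (_ : (fun n => _) =
    -%E \o (fun n => (birkhoff psi n x / birkhoff v n x)%:E)); last first.
    by apply/funext => n /=; rewrite birkhoffN mulNr EFinN.
  by rewrite limn_einfN EFinN lteN2.
have [x [n xn]] := unbounded_above cv0 vcv al' C; exists x, n.
rewrite (le_trans xn)// birkhoffN birkhoff_lin birkhoff_lin birkhoffN; lra.
Qed.

Lemma holderN (R : realType) (T : Type) (d : T -> T -> R) f :
  holder d f -> holder d (fun x => - f x).
Proof.
move=> [C [th [th0 h]]]; exists C, th; split=> // x y.
by rewrite -opprD normrN.
Qed.

(** Some first letter carries at least the average over the letters. A common first letter lets any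
    block follow any tail, and the subtype serves as the alphabet of the Cantor set. *)
Lemma pigeonhole_first (R : realType) (A : finType) n (G : pred (n.+1.-tuple A))
    (F : n.+1.-tuple A -> R) q : (0 < #|A|)%N ->
  q < \sum_(t | G t) F t ->
  exists b, q <= #|A|%:R * \sum_(i : {t | G t && (thead t == b)}) F (val i).
Proof.
move=> A0; rewrite (partition_big (@thead n A) xpredT)//= => qF.
apply: contrapT => /forallNP small.
have A0R : 0 < #|A|%:R :> R by rewrite ltr0n.
move: qF; rewrite ltNge => /negP; apply; rewrite -(ler_pM2l A0R) mulr_sumr.
have -> : #|A|%:R * q = \sum_(b : A) q by rewrite sumr_const mulr_natl.
apply: ler_sum => b _.
have /negP := small b; rewrite -ltNge => /ltW; apply: le_trans; rewrite ler_pM2l//.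
rewrite (reindex_omap (val : {t | G t && (thead t == b)} -> _) insub) => [|t Gt];
  last by rewrite insubT.
rewrite le_eqVlt; apply/orP; left; apply/eqP.
by apply: eq_bigl => i; rewrite (valP i) valK eqxx.
Qed.

(** * Comparison of the level set with the Cantor set *)

Section Core.
Context (R : realType) (A : finType) (M : rel A).
Hypothesis A0 : (0 < #|A|)%N.
Hypothesis Mtrans : sft_transitive M.
Context (W : set (seq A)).
Hypothesis Wfin : finite_set W.
Hypothesis WM : forall w, W w -> sorted M w.
Context (phi : sft M -> R) (D B : R).
Hypothesis D0 : 0 <= D.
Hypothesis B0 : 0 <= B.
Hypothesis phiD : distortion phi D.
Hypothesis phiB : forall x, `|phi x| <= B.
Hypothesis phi_above : forall C, exists x n, C <= birkhoff phi n x.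
Hypothesis phi_below : forall C, exists x n, C <= birkhoff (fun z => - phi z) n x.

Lemma signed_tails : exists L : nat, forall b m, exists tail : bool -> A -> seq A,
  [/\ forall s a, path M a (rcons (tail s a) b),
      forall s a, (size (tail s a) <= L * m.+1)%N,
      forall s a w, W w -> infix w (tail s a) &
      forall (s : bool) a y, cylinder M (tail s a) y ->
        m%:R <= (if s then 1 else -1) * birkhoff phi (size (tail s a)) y].
Proof.
have [L1 h1] := tails Mtrans phiD phiB A0 Wfin WM D0 B0 phi_above.
have phiND : distortion (fun z => - phi z) D.
  by move=> n x y /phiD; rewrite !birkhoffN -opprD normrN.
have phiNB x : `|- phi x| <= B by rewrite normrN.
have [L2 h2] := tails Mtrans phiND phiNB A0 Wfin WM D0 B0 phi_below.
exists (L1 + L2)%N => b m.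
have /choice[t1 t1P] : forall a, _ := fun a => h1 a b m.
have /choice[t2 t2P] : forall a, _ := fun a => h2 a b m.
exists (fun s => if s then t1 else t2); split=> [] [] a.
- by have [] := t1P a.
- by have [] := t2P a.
- by have [_ h _ _] := t1P a; apply: leq_trans h _; rewrite leq_mul2r leq_addr orbT.
- by have [_ h _ _] := t2P a; apply: leq_trans h _; rewrite leq_mul2r leq_addl orbT.
- by have [_ _ h _] := t1P a.
- by have [_ _ h _] := t2P a.
- by have [_ _ _ h] := t1P a => y /h; rewrite mul1r.
- by have [_ _ _ h] := t2P a => y /h; rewrite birkhoffN mulN1r.
Qed.

Context (u : sft M -> R) (Du Bu c : R).
Hypothesis Du0 : 0 <= Du.
Hypothesis uD : distortion (fun z => - u z) Du.
Hypothesis c0 : 0 < c.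
Hypothesis uc : forall x, c <= u x.
Hypothesis Bu0 : 0 <= Bu.
Hypothesis uB : forall x, `|u x| <= Bu.
Let wb := word_birkhoff (fun z => - u z).

(** Lowering the exponent from [s] to [r'] gains a factor [e^(2 kap)] per letter, since [wb] is at
    most [- c] times the length. The lower bound [q ^+ n.+1] on the total weight uses up [e^kap] per
    letter. The tails and the constants each take at most half of the rest. *)
Lemma hausdorff_measure_bounded (L E : set (sft M)) (r s : R) :
  (forall x, L x -> forall e, 0 < e ->
     exists N, forall n, (N <= n)%N -> `|birkhoff phi n x| <= e * n%:R) ->
  (forall x C, (forall k, `|birkhoff phi k x| <= C) -> frequent M W x -> E x) ->
  0 <= r < s -> hausdorff_measure (distu u) s L <> 0 ->
  hausdorff_measure (distu u) r E <> 0.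
Proof.
move=> Lsub Esup /andP[r0 rs] Ls.
have [Lam tailsP] := signed_tails.
(* Strictly above [r], hence positive even for [r = 0], and strictly below [s]. *)
pose r' := (r + s) / 2.
have r'0 : 0 < r' by rewrite /r'; lra.
have rr' : 0 <= r <= r' by rewrite r0 /r'; lra.
have r's : r' < s by rewrite /r'; lra.
pose kap := (s - r') * c / 2.
have kap0 : 0 < kap by rewrite divr_gt0// mulr_gt0// subr_gt0.
(* The cost in the exponent of one unit of [m], through the [Lam] letters that it allows in a
   tail. *)
pose T := r' * (Lam%:R * Bu).
have T0 : 0 <= T by apply: mulr_ge0 (ltW r'0) _; rewrite mulr_ge0.
pose eps := kap / (2 * (T + 1)).
have eps0 : 0 < eps by rewrite divr_gt0// mulr_gt0//; lra.
have Teps : T * eps <= kap / 2.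
  rewrite /eps mulrA ler_pdivrMr; last by lra.
  by nra.
(* The terms that do not grow with [n]: [#|A|], at most its exponential, for fixing the first
   letter; [Du + Du] for the distortion of [u]; and [D + 2] for distortion and rounding in
   [m.+1]. *)
pose K := #|A|%:R + r' * (Du + Du) + T * (D + 2).
pose G (w : seq A) := `[< exists x, cylinder M w x /\
  `|birkhoff phi (size w) x| <= eps * (size w)%:R >].
pose q := expR (- kap).
have q01 : 0 < q < 1 by rewrite expR_gt0 expR_lt1 oppr_lt0.
(* Otherwise the words of [G] of each large length would have total weight at most a power of [q],
   and [L] would be null. *)
have [n [nbig sumn]] : exists n, K <= kap / 2 * n.+1%:R /\
    q ^+ n.+1 < \sum_(t : n.+1.-tuple A | G t) expR (s * wb t).
  pose N0 := (Num.Def.archi_bound (K / (kap / 2))).+1.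
  apply: contrapT => /forallNP nobig; apply: Ls.
  apply: (@hausdorff_measure_null _ _ _ u Du c uD c0 uc G L s q N0) => //.
  - by apply: ltW; apply: lt_trans r's.
  - move=> x /Lsub/(_ eps eps0)[N hN]; exists N => n /hN h.
    by apply/asboolP; exists x; rewrite size_block; split => //; exact: cylinder_block.
  - move=> [//|n]; rewrite ltnS => Nn; rewrite leNgt; apply/negP => lt.
    apply: (nobig n); split => //.
    have kap2 : 0 < kap / 2 by lra.
    rewrite mulrC -ler_pdivrMr//; apply: le_trans (ler_norm _) _.
    apply: (@le_trans _ _ (Num.Def.archi_bound (K / (kap / 2)))%:R).
      rewrite ltW//; have := archi_boundP (normr_ge0 (K / (kap / 2))).
      by rewrite /Num.Def.archi_bound normr_id.
    by rewrite ler_nat ltnW.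
have [b bsum] := pigeonhole_first A0 sumn.
pose I : finType := {t : n.+1.-tuple A | G t && (thead t == b)}.
(* [G] bounds the sum at one point of each cylinder; adding [D] covers all its points. *)
pose m := (Num.truncn (eps * n.+1%:R + D)).+1.
have em0 : 0 <= eps * n.+1%:R + D by rewrite addr_ge0// mulr_ge0// ltW.
have [mlo mhi] : eps * n.+1%:R + D <= m%:R /\ m%:R <= eps * n.+1%:R + D + 1.
  have /andP[h1 h2] := truncn_itv em0; split; first exact: ltW.
  by rewrite /m -natr1 lerD2r.
have [tail [t1 t2 t3 t4]] := tailsP b m.
pose w (i : I) : seq A := behead (tval (sval i)).
have wE (i : I) : tval (sval i) = b :: w i.
  by rewrite /w; case: i => t /= /andP[_ /eqP <-]; case/tupleP: t => a t; rewrite theadE.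
have w_inj : injective w.
  move=> i j ij; apply/val_inj/val_inj.
  by rewrite -[LHS]/(tval (sval i)) -[RHS]/(tval (sval j)) !wE ij.
have w_size (i : I) : size (w i) = n by rewrite size_behead size_tuple.
have Gw (i : I) : exists x, cylinder M (b :: w i) x /\
    `|birkhoff phi n.+1 x| <= eps * n.+1%:R.
  have /andP[/asboolP[x [h1 h2]] _] := svalP i; exists x; rewrite -wE; split => //.
  by move: h2; rewrite size_tuple.
have w_path i : path M b (w i).
  have [x [/esym wx _]] := Gw i; rewrite -[path _ _ _]/(sorted M (b :: w i)) wx.
  exact: block_sorted.
have w_phi i y : cylinder M (b :: w i) y -> `|birkhoff phi n.+1 y| <= m%:R.
  move=> yi; have [x [xi hx]] := Gw i; apply: le_trans mlo.
  have := phiD (etrans yi (esym xi)); rewrite /= w_size.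
  have := ler_normD (birkhoff phi n.+1 y - birkhoff phi n.+1 x) (birkhoff phi n.+1 x).
  by rewrite subrK; lra.
apply: (hausdorff_measure_cantor (phi := phi) w_inj w_size w_path t1 t2
  Du0 uD c0 uc uB rr' r'0); last first.
  move=> xi x xP.
  apply: (Esup x _ (path_birkhoff_bounded w_size t2 xP D0 B0 phiD phiB w_phi t4)).
  exact: (path_frequent w_size t2 xP t3).
have A0R : 0 < #|A|%:R :> R by rewrite ltr0n.
rewrite -(ler_pM2l A0R).
apply: (@le_trans _ _ (expR (kap * n.+1%:R))).
  apply: (@le_trans _ _ (expR #|A|%:R * expR (r' * (Du + Du + (Lam * m.+1)%:R * Bu)))).
    rewrite ler_wpM2r ?expR_ge0//; apply: le_trans (expR_ge1Dx _); lra.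
  rewrite -expRD ler_expR natrM -natr1.
  have : T * (m%:R + 1) <= T * (eps * n.+1%:R + (D + 2)) by apply: ler_wpM2l => //; lra.
  have : T * eps * n.+1%:R <= kap / 2 * n.+1%:R by apply: ler_wpM2r.
  move: nbig; rewrite /K /T; nra.
apply: (@le_trans _ _ (expR (2 * kap * n.+1%:R) * q ^+ n.+1)).
  by rewrite /q -expRM_natl -expRD ler_expR; lra.
apply: (@le_trans _ _ (expR (2 * kap * n.+1%:R) *
  (#|A|%:R * \sum_(i : I) expR (s * wb (tval (sval i)))))).
  by rewrite ler_wpM2l// expR_ge0.
rewrite mulrCA ler_pM2l// mulr_sumr; apply: ler_sum => i _.
rewrite -expRD ler_expR wE.
have [x [xi _]] := Gw i.
have := word_birkhoff_opp_le uc xi; rewrite /= w_size -/wb => wbx.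
have : (s - r') * wb (b :: w i) <= (s - r') * (- (n.+1%:R * c)).
  by rewrite ler_pM2l// subr_gt0.
have -> : 2 * kap = (s - r') * c by rewrite /kap mulrC divfK.
by lra.
Qed.

End Core.

Theorem theorem1p2 (R : realType) (A : finType) (M : rel A)
  (hA : (2 <= #|A|)%N)
  (hM : forall a : A, exists b : A, M a b)
  (htrans : sft_transitive M)
  (psi v u : sft M -> R)
  (hpsi : holder (@dist1 R A M) psi)
  (hv : holder (@dist1 R A M) v) (v_lt0 : forall x : sft M, v x < 0)
  (hu : holder (@dist1 R A M) u) (u_gt0 : forall x : sft M, 0 < u x)
  (W : set (seq A)) (hWfin : finite_set W)
  (hWadm : forall w : seq A, W w -> sorted M w)
  (alpha : R)
  (halpha_minus : alpha%:E <> alpha_minus psi v)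
  (halpha_plus : alpha%:E <> alpha_plus psi v) :
  udim u (uniform_level_set psi v alpha `&` frequent M W)
  = udim u (level_set psi v alpha).
Proof.
have A0 : (0 < #|A|)%N by exact: leq_trans hA.
have [Dp Dp0 psiD] := holder_distortion hpsi.
have [Bp Bp0 psiB] := holder_bounded hM A0 hpsi.
have [Dv Dv0 vD] := holder_distortion hv.
have [Bv Bv0 vB] := holder_bounded hM A0 hv.
have [Du Du0 uD] := holder_distortion (holderN hu).
have [Bu Bu0 uB] := holder_bounded hM A0 hu.
have [cu cu0 ucu] := holder_pos A0 hM hu u_gt0.
have [cv cv0 vcv'] : exists2 cv : R, 0 < cv & forall x, cv <= - v x.
  by apply: (holder_pos A0 hM (holderN hv)) => x; rewrite oppr_gt0.
have vcv x : v x <= - cv by have := vcv' x; lra.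
have ULsub := uniform_level_set_sub (psi := psi) (alpha := alpha) cv0 vcv.
apply/eqP; rewrite eq_le; apply/andP; split.
  by apply: hausdorff_dim_subset => x [/ULsub].
apply: le_hausdorff_dim => r s rs ULr; apply: contrapT => Ls.
(* An empty level set would be null, being covered by the cylinders of no words at all. *)
have [x Lx] : exists x, level_set psi v alpha x.
  apply: contrapT => /forallNP L0; apply: Ls.
  apply: (@hausdorff_measure_null
    _ _ _ u Du cu uD cu0 ucu pred0 _ s (2^-1) 0) => [|||n _].
  - by case/andP: rs => r0 /ltW; apply: le_trans.
  - by apply/andP; split; lra.
  - by move=> x /L0.
  - by rewrite big_pred0// exprn_ge0.
pose ratio n := (birkhoff psi n x / birkhoff v n x)%:E.
(* A point of the level set places [alpha] between the boundary values, and the hypotheses make both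
   inequalities strict. *)
have [einfx esupx] : limn_einf ratio = alpha%:E /\ limn_esup ratio = alpha%:E.
  have /cvg_limn_einf_sup[-> ->//] : ratio @ \oo --> alpha%:E.
  by apply: cvg_EFin => //; exact: nearW.
have above : forall C, exists x n, C <= birkhoff (fun z => psi z - alpha * v z) n x.
  apply: unbounded_above cv0 vcv _.
  rewrite lt_neqAle; apply/andP; split; first exact/eqP/nesym.
  by rewrite -einfx; apply: ereal_inf_lbound; exists x.
have below : forall C, exists x n, C <= birkhoff (fun z => - (psi z - alpha * v z)) n x.
  apply: unbounded_below cv0 vcv _; rewrite lt_neqAle; apply/andP; split; first exact/eqP.
  by rewrite -esupx; apply: ereal_sup_ubound; exists x.
have phiD : distortion (fun z => psi z - alpha * v z) (Dp + `|alpha| * Dv).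
  move=> n y z yz; rewrite !birkhoff_lin.
  have -> : birkhoff psi n y - alpha * birkhoff v n y -
      (birkhoff psi n z - alpha * birkhoff v n z) =
    (birkhoff psi n y - birkhoff psi n z) - alpha * (birkhoff v n y - birkhoff v n z) by lra.
  by apply: le_trans (ler_normB _ _) _; rewrite normrM lerD ?psiD// ler_wpM2l// vD.
have phiB y : `|psi y - alpha * v y| <= Bp + `|alpha| * Bv.
  by apply: le_trans (ler_normB _ _) _; rewrite normrM lerD ?psiB// ler_wpM2l.
have D0 : 0 <= Dp + `|alpha| * Dv by rewrite addr_ge0// mulr_ge0.
have B0 : 0 <= Bp + `|alpha| * Bv by apply: addr_ge0 (ltW Bp0) _; rewrite mulr_ge0// ltW.
apply: (hausdorff_measure_bounded A0 htrans hWfin hWadm D0 B0 phiD phiB above below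
  Du0 uD cu0 ucu (ltW Bu0) uB _ _ rs Ls ULr).
- by move=> y Ly e e0; exact: (level_set_sublinear cv0 vcv e0 Bv0 vB Ly).
- move=> y C yC Fy; split => //; rewrite /uniform_level_set /mkset.
  apply: (@le_lt_trans _ _ C%:E); last exact: ltry.
  by apply: ge_ereal_sup => _ [n _ <-]; rewrite lee_fin -birkhoff_lin.
Qed.
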